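(* Consider a sequence of $M/GI/\infty$ queues indexed by $n\in\mathbb{N}^*$, where the $n$-th system has initial profile $\mu_0^n$ (a random element of $\mathcal{M}_f^+$), Poisson arrivals of intensity $\lambda^n$, and i.i.d. service times with nonatomic distribution $\alpha^n$ satisfying $\langle\alpha^n,I\rangle<\infty$. Let $(\mu^n_t)_{t\ge0}$ be its profile process and $\bar\mu^n$ the normalized profile process. Assume: (i) $\lambda^n\to\lambda$ for some $\lambda>0$; (ii) for every $\varepsilon>0$ there is $M_\varepsilon>0$ with $\mathbf{P}[\langle\mu_0^n,\mathbf{1}\rangle>nM_\varepsilon]\le\varepsilon$ for all $n$; (iii) there is $\bar\mu_0^*\in\mathcal{M}_f^+$ with $\langle\bar\mu_0^*,I\rangle<\infty$ such that $\langle\bar\mu_0^n,f\rangle\to\langle\bar\mu_0^*,f\rangle$ in probability for every $f\in\mathcal{D}_b$; (iv) there is a nonatomic probability distribution $\bar\alpha^*$ such that $\bar\alpha^n\to\bar\alpha^*$ weakly and $\langle\bar\alpha^n,I\rangle\to\langle\bar\alpha^*,I\rangle<\infty$. Then $\bar\mu^n\Rightarrow\bar\mu^*$ in $\mathcal{D}([0,\infty),\mathcal{M}_f^+)$, where $\bar\mu^*$ is the deterministic element of $\mathcal{C}([0,\infty),\mathcal{M}_f^+)$ defined for all $t\ge0$ and all $\phi\in\mathcal{D}_b$ by $$\langle\bar\mu_t^*,\phi\rangle=\langle\bar\mu_0^*,\tau_t\phi\rangle+\lambda\int_0^t\langle\bar\alpha^*,\tau_s\phi\rangle\,ds.$$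
   Context: $\mathcal{M}_f^+$ is the set of finite nonnegative measures on $\mathbb{R}$ with the weak topology $\sigma(\mathcal{M}_f^+,\mathcal{C}_b)$; $\langle\mu,f\rangle=\int f\,d\mu$. $\mathcal{D}_b$ is the set of bounded right-continuous real functions on $\mathbb{R}$ with left limits; $\mathbf{1}$ is the constant function $1$, $I(x)=x$. For a function $f$, $\tau_xf(\cdot)=f(\cdot-x)$; for a measure, $\tau_x\nu(B)=\nu(B-x)$. $\mathcal{D}([0,\infty),\mathcal{M}_f^+)$ carries the Skorokhod topology, $\Rightarrow$ denotes convergence in distribution. The $n$-th $M/GI/\infty$ queue: customers arrive at the points $T_i^n$ of a Poisson process $(N^n_t)$ of intensity $\lambda^n$, the $i$-th customer requests service time $\sigma_i^n$ (i.i.d. with law $\alpha^n$, independent of arrivals) and is served immediately. Its profile process is $\mu_t^n=\tau_t\mu_0^n+\sum_{i=1}^{N_t^n}\delta_{T_i^n+\sigma_i^n-t}$ (atoms at remaining processing times). The normalized process is defined by $\bar\mu_t^n(B)=\mu^n_{nt}(nB)/n$ for Borel $B$, where $nB=\{nx:x\in B\}$; in particular $\bar\mu^n_0(B)=\mu^n_0(nB)/n$. $\bar\alpha^n$ is the law of $\sigma^n/n$, i.e. $\bar\alpha^n(B)=\alpha^n(nB)$.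
   Formalization: The shift of a measure is taken as τ_xν(B)=ν(B+x), i.e. ⟨τ_xν,f⟩=⟨ν,τ_xf⟩, instead of the stated τ_xν(B)=ν(B−x), under which residual times of initial customers would grow and the limit formula would fail (e.g. μ_0^n=nδ_n). *)

(* Defs.v *)
From HB Require Import structures.
From mathcomp Require Import all_boot all_order all_algebra.
From mathcomp Require Import all_classical all_reals all_analysis.
From mathcomp Require Import measurable_realfun.
Set Implicit Arguments. Unset Strict Implicit. Unset Printing Implicit Defensive.
Import Order.TTheory GRing.Theory Num.Theory numFieldNormedType.Exports.
Local Open Scope classical_set_scope.
Local Open Scope ring_scope.

Section Defs.
Variable R : realType.

(* A (raw) set function on the Borel sets of R; elements of M_f^+ are the
   set functions satisfying [fin_meas]. *)
Definition fmeas := set R -> \bar R.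

Definition fin_meas (m : fmeas) : Prop :=
  m set0 = 0%E /\ (forall B, measurable B -> (0 <= m B)%E) /\
  semi_sigma_additive m /\ (m setT < +oo)%E.

Definition pairing (m : fmeas) (f : R -> R) : R := fine (\int[m]_x (f x)%:E).

Definition Cb (f : R -> R) : Prop :=
  continuous f /\ exists M : R, forall x, `|f x| <= M.

Definition Db (f : R -> R) : Prop :=
  (exists M : R, forall x, `|f x| <= M) /\
  (forall x, f y @[y --> x^'+] --> f x) /\
  (forall x, cvg (f y @[y --> x^'-])).

Definition wcvg {U : Type} (F : set_system U)
  (m : U -> fmeas) (nu : fmeas) : Prop :=
  forall f, Cb f -> pairing (m u) f @[u --> F] --> pairing nu f.

Definition cadlag (x : R -> fmeas) : Prop :=
  (forall t, 0 <= t -> fin_meas (x t)) /\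
  (forall t, 0 <= t -> wcvg (t^'+) x (x t)) /\
  (forall t, 0 < t -> exists nu, fin_meas nu /\ wcvg (t^'-) x nu).

Definition time_change (l : R -> R) : Prop :=
  l 0 = 0 /\ (forall s, 0 <= s -> 0 <= l s) /\
  {within [set s | 0 <= s], continuous l} /\
  (forall s u, 0 <= s -> s < u -> l s < l u) /\
  (forall u, 0 <= u -> exists s, 0 <= s /\ l s = u).

(* Skorokhod J1 convergence of a sequence in D([0,oo), M_f^+)
   (Ethier-Kurtz Prop. 3.5.3(b)); the uniform closeness in M_f^+ is taken
   for the weak uniformity, i.e. tested against every f in C_b. *)
Definition J1cvg (xs : nat -> R -> fmeas) (x : R -> fmeas) : Prop :=
  exists l : nat -> R -> R, (forall k, time_change (l k)) /\
  (forall T e, 0 < T -> 0 < e -> \forall k \near \oo,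
      forall t, 0 <= t <= T -> `|l k t - t| <= e) /\
  (forall f, Cb f -> forall T e, 0 < T -> 0 < e -> \forall k \near \oo,
      forall t, 0 <= t <= T ->
        `|pairing (xs k t) f - pairing (x (l k t)) f| <= e).

Definition Dcont_bounded (F : (R -> fmeas) -> R) : Prop :=
  (exists M : R, forall x, `|F x| <= M) /\
  (forall xs x, (forall k, cadlag (xs k)) -> cadlag x -> J1cvg xs x ->
     F (xs k) @[k --> \oo] --> F x).

Section Prob.
Context {d : measure_display} {T : measurableType d} (P : probability T R).

Definition cvg_dist (X : nat -> T -> R -> fmeas) (xstar : R -> fmeas) : Prop :=
  forall F, Dcont_bounded F ->
    (\int[P]_w (F (X n w))%:E)%E @[n --> \oo] --> (F xstar)%:E.

Definition mutual_indep {I : eqType} (X : I -> T -> R) : Prop :=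
  forall (s : seq I) (B : I -> set R), uniq s ->
    (forall i, measurable (B i)) ->
    P (\big[setI/setT]_(i <- s) (X i @^-1` B i)) =
    (\prod_(i <- s) P (X i @^-1` B i))%E.

Definition exp_law (lam : R) (E : T -> R) : Prop :=
  forall x, P [set w | E w <= x] =
    (if 0 <= x then 1 - expR (- (lam * x)) else 0)%:E.

Definition random_fmeas (m : T -> fmeas) : Prop :=
  (forall w, fin_meas (m w)) /\
  (forall B, measurable B -> measurable_fun setT ((fun w => m w B) : T -> \bar R)).

End Prob.

(* arrival times T_i = E_0 + ... + E_i (points of the Poisson process) *)
Definition arrival {T : Type} (E : nat -> T -> R) (i : nat) (w : T) : R :=
  \sum_(j < i.+1) E j w.

Definition profile {T : Type} (mu0 : T -> fmeas) (E sig : nat -> T -> R)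
  (w : T) (t : R) : fmeas := fun B =>
  (mu0 w [set x | B (x - t)%R] +
   \sum_(0 <= i <oo)
     (if (arrival E i w <= t)%R
      then (\1_B (arrival E i w + sig i w - t)%R)%:E else 0%E))%E.

Definition nscale (N : R) (m : fmeas) : fmeas := fun B =>
  ((N^-1)%:E * m [set (N * x)%R | x in B])%E.

Definition nprofile {T : Type} (N : R) (mu0 : T -> fmeas) (E sig : nat -> T -> R)
  (w : T) (t : R) : fmeas := nscale N (profile mu0 E sig w (N * t)).

(* law of sigma / N *)
Definition nlaw (N : R) (a : fmeas) : fmeas := fun B => a [set N * x | x in B].

End Defs.

(* Main.v *)
(* A finite measure on the line is determined by its mass and its tails
   [a, oo[, and uniform convergence of these along a countable dense set of
   shifted thresholds [a - t] implies uniform convergence on [0, T] of the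
   pairings with a bounded continuous function, because the limit is tight.
   At time t the tail at a - t of the profile is the tail at a of the initial
   profile plus the number of arrivals before t whose departure time is at
   least a.  Cut the arrivals into blocks of about n lam h customers. By
   Chebyshev's inequality the end of the l-th block is close to l h in
   probability, and the number of customers of the first l blocks whose
   service exceeds n c is close to n lam l h alpha[c, oo[.  Monotonicity in c
   then encloses the number of late departures between two Riemann sums of
   s |-> lam alpha[a - s, oo[ whose difference telescopes.
   Only countably many limits in probability enter, and on sequences of sample
   points along which they all hold the paths converge uniformly; since the
   limit is deterministic this gives convergence in distribution. *)
Require Import Defs.
From HB Require Import structures.
From mathcomp Require Import all_boot all_order all_algebra.
From mathcomp Require Import all_classical all_reals all_analysis.
From mathcomp Require Import measurable_realfun.
From mathcomp Require Import ring lra.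
Import Order.TTheory GRing.Theory Num.Theory numFieldNormedType.Exports.
Local Open Scope classical_set_scope.
Local Open Scope ring_scope.

Set Implicit Arguments.
Unset Strict Implicit.
Unset Printing Implicit Defensive.

(** * Finite measures on the line and their tails *)

(** The shape of the proof comes from measurability and countability. A test functional [F] is only
    sequentially continuous for J1, and [F] of the random path need not be measurable. So the
    randomness is carried by explicit real random variables (initial mass and tails, block ends,
    block counts), and [F] is evaluated only along sequences of sample points chosen in events of
    probability close to 1. Rational thresholds and block lengths [1 / q.+1] keep these variables
    countable: the shifted thresholds [a - m h] are again rational. The initial and service tails
    converge for different reasons. Closed rays have indicators in [Db], so (iii) gives the initial
    tails at every threshold, atoms or not; the service laws converge only against continuous
    functions, and there the limit law must have no atom. Second moments are computed for indicators
    alone. The law of large numbers for interarrival times follows by slicing an exponential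
    variable into levels: finitely many slices are indicators, and Markov's inequality handles the
    remainder. *)

Section FiniteMeasures.
Variable R : realType.
Implicit Types (m : fmeas R) (mu nu : {finite_measure set R -> \bar R}).

(* [fin_meas m] leaves the values of [m] on non-measurable sets unconstrained. *)
Definition restr_meas m (mP : fin_meas m) : set R -> \bar R :=
  fun B => if `[< measurable B >] then m B else 0%E.

Section RestrMeas.
Variables (m : fmeas R) (mP : fin_meas m).

Let restr0 : restr_meas mP set0 = 0%E.
Proof.
by rewrite /restr_meas asboolT; [case: mP | exact: measurable0].
Qed.

Let restr_ge0 B : (0 <= restr_meas mP B)%E.
Proof.
rewrite /restr_meas; case: asboolP => // mB.
by case: mP => _ [+ _]; exact.
Qed.

Let restr_sigma_additive : semi_sigma_additive (restr_meas mP).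
Proof.
move=> F mF tF mUF.
rewrite {2}/restr_meas asboolT// (_ : (fun n => _) =
  (fun n => \sum_(0 <= i < n) m (F i))%E); last first.
  by apply/funext => n; apply: eq_bigr => i _; rewrite /restr_meas asboolT.
by case: mP => _ [_ [+ _]]; exact.
Qed.

HB.instance Definition _ := isMeasure.Build _ R R (restr_meas mP)
  restr0 restr_ge0 restr_sigma_additive.

Let restr_fin : fin_num_fun (restr_meas mP).
Proof.
apply: lty_fin_num_fun => /=.
by rewrite /restr_meas asboolT; [case: mP => _ [_ []] | exact: measurableT].
Qed.

HB.instance Definition _ := Measure_isFinite.Build _ R R (restr_meas mP) restr_fin.

End RestrMeas.

Lemma fin_meas_finite m : fin_meas m ->
  exists mu, forall B, measurable B -> m B = mu B.
Proof.
move=> mP; exists (restr_meas mP) => B mB.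
by rewrite /= /restr_meas asboolT.
Qed.

Lemma measure_fin_meas (m : fmeas R) (nu : {measure set R -> \bar R}) :
  (forall B, measurable B -> m B = nu B) -> (nu setT < +oo)%E -> fin_meas m.
Proof.
move=> mE nuT; split; first by rewrite mE.
split; first by move=> B mB; rewrite mE.
split; last by rewrite mE.
move=> F mF tF mUF; rewrite mE//.
rewrite (_ : (fun n => _) = (fun n => \sum_(0 <= i < n) nu (F i))%E).
  exact: measure_semi_sigma_additive.
by apply/funext => n; apply: eq_bigr => i _; rewrite mE.
Qed.

Lemma finite_fin_meas m mu : (forall B, measurable B -> m B = mu B) -> fin_meas m.
Proof.
by move=> mE; apply: (measure_fin_meas mE); rewrite -ge0_fin_numE// fin_num_measure.
Qed.

Import HBNNSimple.

(** [m1] and [m2] carry no measure structure, so the integral is unfolded: it is built from suprema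
    over simple functions, whose level sets are measurable. *)
Lemma eq_pairing (m1 m2 : fmeas R) f :
  (forall B, measurable B -> m1 B = m2 B) -> pairing m1 f = pairing m2 f.
Proof.
move=> m12; rewrite /pairing /integral; congr fine.
by congr (ereal_sup _ - ereal_sup _)%E; apply: eq_imagel => h _;
  apply: eq_fsbigr => r _; rewrite m12.
Qed.

Definition tail m (c : R) : R := fine (m `[c, +oo[%classic).
Definition mass m : R := fine (m setT).

Lemma bounded_integrable d (T : measurableType d)
    (mu : {finite_measure set T -> \bar R}) (D : set T) (f : T -> R) (M : R) :
  measurable D -> measurable_fun D f -> (forall x, D x -> `|f x| <= M) ->
  mu.-integrable D (EFin \o f).
Proof.
move=> mD mf fM; apply: measurable_bounded_integrable => //.
  by rewrite -ge0_fin_numE// fin_num_measure.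
by exists M; split => [|r Mr x /fM]; [exact: num_real | move=> /le_trans; apply; exact: ltW].
Qed.

Lemma Rintegral_sum d (T : measurableType d)
    (mu : {measure set T -> \bar R}) (I : Type) (s : seq I) (f : I -> T -> R) :
  (forall i, mu.-integrable setT (EFin \o f i)) ->
  \int[mu]_x (\sum_(i <- s) f i x) = \sum_(i <- s) \int[mu]_x f i x.
Proof.
move=> h; elim: s => [|a s IH].
  under eq_Rintegral do rewrite big_nil.
  by rewrite big_nil Rintegral_cst//= mul0r.
under eq_Rintegral do rewrite big_cons.
rewrite big_cons RintegralD//; first by rewrite IH.
apply: (eq_integrable _ (fun x => \sum_(i <- s) (EFin \o f i) x)%E) => //.
  by move=> x _; rewrite /= sumEFin.
exact: integrable_sum.
Qed.

Lemma Rintegral_indic d (T : measurableType d)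
    (mu : {measure set T -> \bar R}) (A : set T) : measurable A ->
  \int[mu]_x \1_A x = fine (mu A).
Proof. by move=> mA; rewrite /Rintegral integral_indic// setIT. Qed.

Lemma indic_integrable d (T : measurableType d)
    (mu : {finite_measure set T -> \bar R}) (A : set T) : measurable A ->
  mu.-integrable setT (EFin \o (\1_A : T -> R)).
Proof.
move=> mA; apply: (@bounded_integrable _ _ mu _ _ 1) => // x _.
by rewrite indicE; case: (_ \in _); rewrite /= ?normr1 ?normr0.
Qed.

(** Each cell [[a i, a i.+1[] is written as a difference of two rays, so that integrating produces
    tails only. *)
Definition step_fun (f : R -> R) (a : nat -> R) n (x : R) : R :=
  \sum_(i < n) f (a i) * (\1_`[a i, +oo[ x - \1_`[a i.+1, +oo[ x).

Lemma indic_ray (c x : R) : \1_`[c, +oo[ x = (c <= x)%R%:R :> R.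
Proof.
rewrite indicE; congr (_%:R); congr nat_of_bool.
by apply/idP/idP; rewrite inE/= in_itv/= andbT.
Qed.

(** The two vanishing clauses carry the induction on [n]: on the last cell the earlier ones
    contribute 0, and before it the last one does. *)
Lemma step_fun_close (f : R -> R) (a : nat -> R) n (eps : R) (x : R) :
  {homo a : i j / (i <= j)%N >-> i <= j} -> 0 <= eps ->
  (forall i y, (i < n)%N -> a i <= y < a i.+1 -> `|f y - f (a i)| <= eps) ->
  [/\ x < a 0%N -> step_fun f a n x = 0, a n <= x -> step_fun f a n x = 0 &
      a 0%N <= x < a n -> `|f x - step_fun f a n x| <= eps].
Proof.
move=> amono eps0; elim: n => [|n IH] osc.
  rewrite /step_fun big_ord0; split => // /andP[h1 h2].
  by have := le_lt_trans h1 h2; rewrite ltxx.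
have [i y ni|h1 h2 h3] := IH; first by apply: osc; rewrite ltnW.
rewrite /step_fun big_ord_recr/= -/(step_fun f a n x) !indic_ray.
have an := amono _ _ (leqnSn n).
have a0 := amono _ _ (leq0n n).
split => [xa|xa|/andP[xa xn]].
- by rewrite h1// (lt_geF (lt_le_trans xa a0)) (lt_geF (lt_le_trans xa (le_trans a0 an))) subrr mulr0 addr0.
- by rewrite (h2 (le_trans an xa)) xa (le_trans an xa) subrr mulr0 addr0.
- rewrite (lt_geF xn) subr0; have [axn|xan] := leP (a n) x.
    by rewrite mulr1 h2// add0r osc// axn.
  by rewrite mulr0 addr0 h3// xa.
Qed.

Lemma Rintegral_step mu (f : R -> R) (a : nat -> R) n :
  \int[mu]_x step_fun f a n x =
  \sum_(i < n) f (a i) * (tail mu (a i) - tail mu (a i.+1)).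
Proof.
rewrite Rintegral_sum => [|i].
  apply: eq_bigr => i _; rewrite RintegralZl//.
    by rewrite RintegralB ?Rintegral_indic//; exact: indic_integrable.
  apply: (eq_integrable _ ((EFin \o \1_`[a i, +oo[%classic) \- (EFin \o \1_`[a i.+1, +oo[%classic))%E) => //.
  by apply: integrableB => //; exact: indic_integrable.
apply: (@bounded_integrable _ _ mu _ _ `|f (a i)|) => //.
  by apply: measurable_funM => //; apply: measurable_funB.
move=> x _; rewrite normrM ler_piMr// !indic_ray.
by case: (a _ <= x); case: (a _ <= x); rewrite ?subrr ?subr0 ?sub0r ?normrN ?normr0 ?normr1.
Qed.

(** Inside [[a 0, a n[] the error is the oscillation of [f] on a cell. Outside, the step function
    vanishes and the error is at most [M], on a set whose mass is the last factor. *)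
Lemma pairing_step_close mu (f : R -> R) (a : nat -> R) n (eps M : R) :
  {homo a : i j / (i <= j)%N >-> i <= j} -> 0 <= eps ->
  measurable_fun setT f -> (forall x, `|f x| <= M) ->
  (forall i y, (i < n)%N -> a i <= y < a i.+1 -> `|f y - f (a i)| <= eps) ->
  `|pairing mu f - \sum_(i < n) f (a i) * (tail mu (a i) - tail mu (a i.+1))| <=
  eps * mass mu + M * (mass mu - tail mu (a 0%N) + tail mu (a n)).
Proof.
move=> amono eps0 mf fM osc.
have M0 : 0 <= M by rewrite (le_trans _ (fM 0)).
have mstep : measurable_fun setT (step_fun f a n).
  apply: measurable_sum => i; apply: measurable_funM => //.
  by apply: measurable_funB.
have bound x : `|f x - step_fun f a n x| <=
    eps + M * (1 - \1_`[a 0%N, +oo[ x + \1_`[a n, +oo[ x).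
  have [h1 h2 h3] := step_fun_close x amono eps0 osc.
  rewrite !indic_ray; have [xa|ax] := ltP x (a 0%N).
    rewrite h1// subr0 (le_trans (fM x))// subr0 (le_trans _ (ler_wpDl eps0 (lexx _)))//.
    by rewrite ler_peMr// lerDl.
  have [anx|xan] := leP (a n) x.
    by rewrite h2// subr0 subrr add0r mulr1 (le_trans (fM x))// lerDr.
  by rewrite subrr addr0 mulr0 addr0 h3// ax.
have intf : mu.-integrable setT (EFin \o f) by exact: (@bounded_integrable _ _ mu _ _ M).
have intd : mu.-integrable setT (EFin \o (fun x => f x - step_fun f a n x)).
  apply: (@bounded_integrable _ _ mu _ _ (eps + M * 2)) => //.
    exact: measurable_funB.
  move=> x _; rewrite (le_trans (bound x))// lerD2l ler_wpM2l// !indic_ray.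
  by case: (a _ <= x); case: (a _ <= x) => /=; lra.
have ints : mu.-integrable setT (EFin \o step_fun f a n).
  pose g x := f x - step_fun f a n x.
  apply: (eq_integrable _ ((EFin \o f) \- (EFin \o g))%E) => //.
    by move=> x _ /=; rewrite -EFinB subKr.
  exact: integrableB.
rewrite -Rintegral_step /pairing -/(Rintegral mu setT f) -RintegralB//.
apply: le_trans (le_normr_Rintegral _ _) _ => //.
have int1 c : mu.-integrable setT (EFin \o (\1_`[c, +oo[ : R -> R)).
  exact: indic_integrable.
have intc (c : R) : mu.-integrable setT (EFin \o cst c).
  by apply: (@bounded_integrable _ _ mu _ _ `|c|).
have intb : mu.-integrable setT (EFin \o (fun x => M * (1 - \1_`[a 0%N, +oo[ x + \1_`[a n, +oo[ x))).
  apply: (@bounded_integrable _ _ mu _ _ (M * 2)) => //.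
    apply: measurable_funM => //; apply: measurable_funD => //.
    exact: measurable_funB.
  move=> x _; rewrite normrM (ger0_norm M0) ler_wpM2l// !indic_ray.
  by case: (a _ <= x); case: (a _ <= x) => /=; rewrite ?subrr ?subr0 ?add0r ?addr0 ?normr0 ?normr1 ?ger0_norm//; lra.
apply: (@le_trans _ _ (\int[mu]_x (eps + M * (1 - \1_`[a 0%N, +oo[ x + \1_`[a n, +oo[ x)))).
  apply: le_Rintegral => //.
  - exact: (integrable_norm intd).
  - pose g x := M * (1 - \1_`[a 0%N, +oo[ x + \1_`[a n, +oo[ x).
    apply: (eq_integrable _ ((EFin \o cst eps) \+ (EFin \o g))%E) => //.
    exact: (integrableD _ (intc eps)).
rewrite RintegralD//; last exact: (intc eps).
have intd1 : mu.-integrable setT (EFin \o (fun x => 1 - \1_`[a 0%N, +oo[ x)).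
  apply: (@bounded_integrable _ _ mu _ _ 1) => //; first exact: measurable_funB.
  by move=> x _; rewrite indic_ray; case: (a _ <= x); rewrite ?subrr ?subr0 ?normr0 ?normr1.
have intd2 : mu.-integrable setT
    (EFin \o (fun x => 1 - \1_`[a 0%N, +oo[ x + \1_`[a n, +oo[ x)).
  exact: (integrableD _ intd1 (int1 (a n))).
rewrite Rintegral_cst// lerD2l RintegralZl// RintegralD//.
rewrite (RintegralB _ (intc 1) (int1 (a 0%N)))//.
by rewrite Rintegral_cst// mul1r !Rintegral_indic.
Qed.

(** Each cell involves two tails, hence [2 * eta] per cell between the two sums. Replacing the mass
    of [mu] outside the window by that of [nu] costs [3 * eta]: one for the total mass and one for
    each end. *)
Lemma pairing_tails_close mu nu (f : R -> R) (a : nat -> R) n (eps eta M : R) :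
  {homo a : i j / (i <= j)%N >-> i <= j} -> 0 <= eps ->
  measurable_fun setT f -> (forall x, `|f x| <= M) ->
  (forall i y, (i < n)%N -> a i <= y < a i.+1 -> `|f y - f (a i)| <= eps) ->
  (forall i, (i <= n)%N -> `|tail mu (a i) - tail nu (a i)| <= eta) ->
  `|mass mu - mass nu| <= eta ->
  `|pairing mu f - pairing nu f| <=
  eps * (2 * mass nu + eta) +
  M * (2 * (mass nu - tail nu (a 0%N) + tail nu (a n)) + 3 * eta) +
  2 * M * eta * n%:R.
Proof.
move=> amono eps0 mf fM osc tl ms.
have M0 : 0 <= M by rewrite (le_trans _ (fM 0)).
have Hmu := pairing_step_close mu amono eps0 mf fM osc.
have Hnu := pairing_step_close nu amono eps0 mf fM osc.
set Smu := \sum_(i < n) _ in Hmu; set Snu := \sum_(i < n) _ in Hnu.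
have HS : `|Smu - Snu| <= 2 * M * eta * n%:R.
  rewrite /Smu /Snu -sumrB (le_trans (ler_norm_sum _ _ _))//.
  rewrite (le_trans (_ : _ <= \sum_(i < n) 2 * M * eta))//; last first.
    by rewrite sumr_const card_ord mulr_natr.
  apply: ler_sum => i _; rewrite -mulrBr normrM.
  have := tl i (ltnW (ltn_ord i)); have := tl i.+1 (ltn_ord i).
  rewrite -mulrA mulrCA => h1 h2; apply: ler_pM => //.
  move: h1 h2; rewrite !ler_norml => /andP[? ?] /andP[? ?].
  by apply/andP; split; lra.
have h0 := tl 0%N (leq0n n); have hn := tl n (leqnn n).
have E1 : mass mu <= mass nu + eta by move: ms; rewrite ler_norml => /andP[]; lra.
have E2 : mass mu - tail mu (a 0%N) + tail mu (a n) <=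
    mass nu - tail nu (a 0%N) + tail nu (a n) + 3 * eta.
  by move: h0 hn; rewrite !ler_norml => /andP[? ?] /andP[? ?]; lra.
have := ler_wpM2l eps0 E1; have := ler_wpM2l M0 E2.
move: Hmu Hnu HS; rewrite !ler_norml => /andP[? ?] /andP[? ?] /andP[? ?] ? ?.
by apply/andP; split; lra.
Qed.

(** Heine-Cantor with only [x] confined to the compact interval: [y] may lie slightly outside it. *)
Lemma continuous_unif (f : R -> R) (A e : R) : continuous f -> 0 < e ->
  exists2 dl : R, 0 < dl & forall x y, `|x| <= A -> `|x - y| < dl -> `|f x - f y| <= e.
Proof.
move=> cf e0.
have cptA : compact `[- A, A]%classic by exact: segment_compact.
have nA : \forall dl \near 0%R^'+, `[- A, A]%classic `<=`
    (fun x => forall y, `|x - y| < dl -> `|f x - f y| <= e).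
  move/compact_near_coveringP : cptA; apply => x _.
  have e2 : 0 < e / 2 by rewrite divr_gt0.
  have /cvgrPdist_lt/(_ _ e2)/nbhs_ballP[r /= r0 rB] := cf x.
  have r2 : 0 < r / 2 by rewrite divr_gt0.
  near=> z => y zy /=.
  have xz : `|x - z.1| < r / 2.
    by near: z; exists (ball x (r / 2), [set: R]) => /=; [split; [exact: nbhsx_ballx | exact: filterT] | move=> ? []].
  have dr : z.2 < r / 2.
    by near: z; exists ([set: R], [set u | u < r / 2]) => /=; [split; [exact: filterT | exact: nbhs_right_lt] | move=> ? []].
  have h1 : `|f x - f z.1| < e / 2 by apply: rB; rewrite /ball/=; lra.
  have h2 : `|f x - f y| < e / 2.
    apply: rB; rewrite /ball/= (_ : x - y = (x - z.1) + (z.1 - y)); last by ring.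
    by rewrite (le_lt_trans (ler_normD _ _))//; lra.
  rewrite (_ : f z.1 - f y = (f x - f y) - (f x - f z.1)); last by ring.
  by rewrite (le_trans (ler_normB _ _))//; lra.
have [dl [dl0 H]] : exists dl : R, 0 < dl /\ `[- A, A] `<=` (fun x => forall y, `|x - y| < dl -> `|f x - f y| <= e).
  have : \forall dl \near 0%R^'+, 0 < dl /\ `[- A, A]%classic `<=` (fun x => forall y, `|x - y| < dl -> `|f x - f y| <= e).
    near=> dl; split; near: dl => //; exact: nbhs_right_gt.
  by move=> /filter_ex[dl H]; exists dl.
exists dl => // x y xA; apply: H => /=.
by rewrite in_itv/= -ler_norml.
Unshelve. all: end_near. Qed.

Lemma eq_tail (m1 m2 : fmeas R) c :
  (forall B, measurable B -> m1 B = m2 B) -> tail m1 c = tail m2 c.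
Proof. by move=> m12; rewrite /tail m12. Qed.

Lemma eq_mass (m1 m2 : fmeas R) :
  (forall B, measurable B -> m1 B = m2 B) -> mass m1 = mass m2.
Proof. by move=> m12; rewrite /mass m12. Qed.

(* [a] is a fixed threshold before the time shift: [y - t] lies in [a - t, oo[
   iff [y] lies in [a, oo[. *)
Lemma unif_pairing_cvg (X : nat -> R -> fmeas R) (x : R -> fmeas R) (Tm C : R)
    (f : R -> R) (e : R) :
  (forall k t, 0 <= t <= Tm -> fin_meas (X k t)) ->
  (forall t, 0 <= t <= Tm -> fin_meas (x t)) ->
  (forall (a : rat) (e : R), 0 < e -> \forall k \near \oo, forall t, 0 <= t <= Tm ->
    `|tail (X k t) (ratr a - t) - tail (x t) (ratr a - t)| <= e) ->
  (forall e : R, 0 < e -> \forall k \near \oo, forall t, 0 <= t <= Tm ->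
    `|mass (X k t) - mass (x t)| <= e) ->
  (forall t, 0 <= t <= Tm -> mass (x t) <= C) ->
  (forall e : R, 0 < e -> exists K : nat, forall t, 0 <= t <= Tm ->
    mass (x t) - tail (x t) (- K%:R - t) + tail (x t) (K%:R - t) <= e) ->
  Cb f -> 0 < e ->
  \forall k \near \oo, forall t, 0 <= t <= Tm ->
    `|pairing (X k t) f - pairing (x t) f| <= e.
Proof.
move=> finX finx tlX msX msC tight [cf [M0 fM0]] e0.
have [M M1 fM] : exists2 M : R, 1 <= M & forall y, `|f y| <= M.
  by exists (Num.max 1 M0) => [|y]; rewrite le_max ?lexx// fM0 orbT.
have mf : measurable_fun setT f by exact: continuous_measurable_fun.
have Mgt0 : 0 < M by rewrite (lt_le_trans _ M1).
pose C' := `|C| + 1.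
have C'0 : 0 < C' by rewrite ltr_pwDr.
pose eps := Num.min 1 (e / (6 * C')).
have eps0 : 0 < eps by rewrite lt_min ltr01 divr_gt0// mulr_gt0.
have epsC : eps * (2 * C') <= e / 3.
  have : eps <= e / (6 * C') by rewrite ge_min lexx orbT.
  rewrite ler_pdivlMr ?mulr_gt0//; lra.
have [K HK] : exists K : nat, forall t, 0 <= t <= Tm ->
    mass (x t) - tail (x t) (- K%:R - t) + tail (x t) (K%:R - t) <= e / (12 * M).
  by apply: tight; rewrite divr_gt0// mulr_gt0.
(* The grid is later shifted by [t] in [[0, Tm]], which enlarges the window by at most [Tm]. *)
have [dl dl0 Hdl] := continuous_unif (K%:R + `|Tm|) cf eps0.
have [q Hq] : exists q : nat, q.+1%:R^-1 < dl.
  exists (Num.truncn dl^-1); rewrite invf_plt ?posrE//.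
  exact: truncnS_gt.
pose h : R := q.+1%:R^-1.
have h0 : 0 < h by rewrite invr_gt0.
(* The grid goes from [-K] to [K] with mesh [1 / q.+1]. Its points are rational because the tails
   are controlled at rational thresholds only. *)
pose n := (2 * K * q.+1)%N.
pose a (i : nat) : rat := - K%:R + i%:R / q.+1%:R.
have aE i : ratr (a i) = - K%:R + i%:R * h :> R.
  by rewrite /a rmorphD rmorphN /= fmorph_div !rmorph_nat.
have an : ratr (a n) = K%:R :> R.
  rewrite aE /n natrM mulfK ?pnatr_eq0// natrM; ring.
have a0 : ratr (a 0%N) = - K%:R :> R by rewrite aE mul0r addr0.
(* Since [eps <= 1], the terms carrying [eta] add up to at most [eta * (1 + 3 M + 2 M n)], which
   equals [e / 3] for this choice. Oscillation and tightness take [e / 3] and [e / 6]. *)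
pose eta := e / (9 * M + 6 * M * n%:R + 3).
have den0 : 0 < 9 * M + 6 * M * n%:R + 3.
  by rewrite ltr_wpDl// addr_ge0// mulr_ge0// ?mulr_ge0// ltW.
have eta0 : 0 < eta by rewrite divr_gt0.
have etaE : eta * (9 * M + 6 * M * n%:R + 3) = e by rewrite mulfVK// gt_eqF.
have T1 : \forall k \near \oo, forall i : 'I_n.+1, forall t, 0 <= t <= Tm ->
    `|tail (X k t) (ratr (a i) - t) - tail (x t) (ratr (a i) - t)| <= eta.
  by apply: filter_forall => i; exact: tlX.
have T2 := msX eta eta0.
near=> k.
have T1k : forall i : 'I_n.+1, forall t, 0 <= t <= Tm ->
    `|tail (X k t) (ratr (a i) - t) - tail (x t) (ratr (a i) - t)| <= eta.
  by near: k.
have T2k : forall t, 0 <= t <= Tm -> `|mass (X k t) - mass (x t)| <= eta by near: k.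
move=> t tT.
have [mu muE] := fin_meas_finite (finX k t tT).
have [nu nuE] := fin_meas_finite (finx t tT).
rewrite (eq_pairing _ muE) (eq_pairing _ nuE).
pose b i := ratr (a i) - t.
have bmono : {homo b : i j / (i <= j)%N >-> i <= j}.
  by move=> i j ij; rewrite /b !aE lerD2r lerD2l ler_wpM2r ?ler_nat// ltW.
apply: le_trans (@pairing_tails_close mu nu f b n eps eta M bmono (ltW eps0) mf fM _ _ _) _.
- move=> i y ni /andP[y1 y2]; rewrite distrC; apply: Hdl.
    rewrite /b aE ler_norml.
    have i0 : 0 <= i%:R * h by rewrite mulr_ge0// ltW.
    have i1 : i%:R * h <= 2 * K%:R.
      rewrite /h ler_pdivrMr// -!natrM ler_nat; exact: ltnW.
    have := ler_norm Tm; case/andP: tT; move: i0 i1; clear => ? ? ? ? ?.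
    by apply/andP; split; lra.
  move: y1 y2; rewrite /b !aE -[in X in _ -> X -> _]natr1 => y1 y2.
  move: Hq y1 y2; rewrite ltr_norml -/h; clear => *; apply/andP; split; lra.
- move=> i ni; rewrite -(eq_tail _ muE) -(eq_tail _ nuE).
  exact: (T1k (Ordinal (ni : (i < n.+1)%N)) t tT).
- by rewrite -(eq_mass muE) -(eq_mass nuE) T2k.
rewrite -(eq_mass nuE) -!(eq_tail _ nuE) /b a0 an.
have Ht := HK t tT.
have HC : mass (x t) <= C' by have := msC t tT; have := ler_norm C; rewrite /C'; lra.
have HM : M * (2 * (mass (x t) - tail (x t) (- K%:R - t) + tail (x t) (K%:R - t))) <= e / 6.
  rewrite (le_trans (_ : _ <= M * (2 * (e / (12 * M)))))//.
    by rewrite ler_wpM2l// ?ler_wpM2l// ltW.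
  rewrite le_eqVlt; apply/orP; left; apply/eqP; field; exact: lt0r_neq0.
have Heps : eps * (2 * mass (x t)) <= e / 3.
  by rewrite (le_trans _ epsC)// ler_pM2l// ler_pM2l.
have eps1 : eps <= 1 by rewrite ge_min lexx.
have eps_eta : eps * eta <= eta by rewrite ler_piMl// ltW.
move: HM Heps etaE eps_eta e0; clear.
move: n%:R (eta) (eps) (mass (x t)) (mass (x t) - _ + _) => v u p m A1.
rewrite !mulrDr => *; lra.
Unshelve. all: end_near. Qed.

End FiniteMeasures.

(** * Measurability of right-continuous functions *)

Section RightContinuous.
Variable R : realType.

Lemma measurable_comp_truncn (g : nat -> R) (h : R -> R) : measurable_fun setT h ->
  measurable_fun setT (fun x => g (Num.truncn (h x))).
Proof.
move=> mh _ B _; rewrite setTI.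
rewrite (_ : _ @^-1` _ = \bigcup_n (if `[< B (g n) >] then
   h @^-1` [set y | Num.truncn y = n] else set0)); last first.
  apply/seteqP; split => [x /= Bx|x [n _]].
    by exists (Num.truncn (h x)) => //; rewrite asboolT.
  by case: asboolP => //= Bn nE; rewrite nE.
apply: bigcup_measurable => n _; case: ifP => // _.
rewrite -[X in measurable X]setTI; apply: mh => //.
apply: is_interval_measurable => x y /= xn yn z /andP[xz zy].
by apply/eqP; rewrite eqn_leq -[X in (_ <= X)%N && _]yn -[X in _ && (X <= _)%N]xn !le_truncn.
Qed.

(** [f] is the pointwise limit of its values at the grid point following [x], a function of
    countably many values. The point [p m i] lies strictly to the right of [x], as the right limit
    requires. The grid starts at [-m] because [Num.truncn] sends negative numbers to 0. *)
Lemma right_continuous_measurable (f : R -> R) :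
  (forall x, f y @[y --> x^'+] --> f x) -> measurable_fun setT f.
Proof.
move=> rcf.
pose h (m : nat) (x : R) := (x + m%:R) * m.+1%:R.
pose p (m : nat) i : R := i.+1%:R / m.+1%:R - m%:R.
apply: (@measurable_fun_cvg _ _ _ _ (fun m x => f (p m (Num.truncn (h m x))))) => [m|x _].
  apply: (measurable_comp_truncn (fun i => f (p m i))).
  by apply: measurable_funM => //; apply: measurable_funD.
apply/cvgrPdist_lt => e e0.
move/cvgrPdist_lt : (rcf x) => /(_ e e0); rewrite near_withinE => /nbhs_ballP[dl /= dl0 H].
near=> m; apply: H; rewrite /ball/=.
  have xm : 0 <= x + m%:R.
    have : - x < m%:R by near: m; exact: nbhs_infty_gtr.
    lra.
  have m0 : 0 < (m.+1%:R : R) by rewrite ltr0n.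
  have hm0 : 0 <= h m x by rewrite mulr_ge0// ltW.
  have /andP[h1 h2] := truncn_itv hm0.
  have p1 : x < p m (Num.truncn (h m x)).
    by rewrite /p ltrBrDr ltr_pdivlMr.
  have p2 : p m (Num.truncn (h m x)) <= x + m.+1%:R^-1.
    rewrite /p lerBlDr ler_pdivrMr// -natr1 (le_trans (lerD h1 (lexx 1)))//.
    by rewrite /h addrAC [leRHS]mulrDl mulVf// gt_eqF.
  have : m.+1%:R^-1 < dl.
    rewrite invf_plt ?posrE//; apply: (@lt_trans _ _ m%:R); last by rewrite ltr_nat.
    by near: m; exact: nbhs_infty_gtr.
  move: p1 p2; set pm := p m _ => p1 p2 Hm; by rewrite ltr0_norm ?subr_lt0// opprB (le_lt_trans _ Hm)// lerBlDl.
have xm : 0 <= x + m%:R.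
  have : - x < m%:R by near: m; exact: nbhs_infty_gtr.
  lra.
have hm0 : 0 <= h m x by rewrite mulr_ge0.
have /andP[h1 h2] := truncn_itv hm0.
by rewrite /p ltrBrDr ltr_pdivlMr.
Unshelve. all: end_near. Qed.

End RightContinuous.

(** * The fluid limit *)

Section Limit.
Variables (R : realType) (mu : {finite_measure set R -> \bar R}).
Variables (al : probability R R) (lam : R).

Lemma pairing_indic (nu : {measure set R -> \bar R}) (B : set R) : measurable B ->
  pairing nu \1_B = fine (nu B).
Proof. exact: Rintegral_indic. Qed.

Lemma le_norm_pairing (nu : {finite_measure set R -> \bar R}) (f : R -> R) (M : R) :
  measurable_fun setT f -> (forall x, `|f x| <= M) ->
  `|pairing nu f| <= M * mass nu.
Proof.
move=> mf fM.
have intf : nu.-integrable setT (EFin \o f) by exact: (@bounded_integrable _ _ _ nu _ _ M).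
rewrite /pairing -/(Rintegral nu setT f).
apply: le_trans (le_normr_Rintegral _ intf) _ => //.
rewrite -(Rintegral_cst nu measurableT); apply: le_Rintegral => //.
  exact: integrable_norm.
exact: (@bounded_integrable _ _ _ nu _ _ `|M|).
Qed.

Local Notation RR := (measurableTypeR R).

Let leb_itv_lty (t : R) : ((@lebesgue_measure R) `[0%R, t]%classic < +oo)%E.
Proof.
by rewrite lebesgue_measure_itv/=; case: ifP => _; rewrite ?ltry// -EFinB ltry.
Qed.

Definition time_meas (t : R) : {finite_measure set RR -> \bar R} :=
  @mfrestr _ RR R _ (@lebesgue_measure R) (measurable_itv `[0%R, t]) (leb_itv_lty t).

Lemma integral_time_meas t (f : RR -> R) (M : R) : measurable_fun setT f ->
  (forall x, `|f x| <= M) ->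
  (\int[time_meas t]_s (f s)%:E)%E =
  (\int[lebesgue_measure]_(s in `[0%R, t]%classic) (f s)%:E)%E.
Proof.
move=> mf fM.
transitivity (\int[time_meas t]_(s in setT `\` ~` `[0%R, t]%classic) (f s)%:E)%E.
  apply: (@negligible_integral _ RR R (time_meas t)) => //.
  - exact: measurableC.
  - exact: (@bounded_integrable _ _ _ (time_meas t) _ _ M).
  - by rewrite /= /mfrestr /mrestr setICl measure0.
rewrite setTD setCK; apply: eq_measure_integral => A mA At.
by rewrite /= /mfrestr /mrestr setIidl.
Qed.

(** [z.1] is the time elapsed since an arrival and [z.2] the service it requested, so [z.2 - z.1] is
    the remaining time. It is negative for customers already gone, whose atoms the profile keeps. *)
Definition fluid_limit (t : R) : fmeas R := fun B =>
  (mu [set x | B (x - t)%R] +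
   lam%:E * (time_meas t \x al)%E [set z : RR * R | B (z.2 - z.1)%R])%E.

Let diff (z : RR * R) : R := z.2 - z.1.

Let measurable_diff : measurable_fun setT diff.
Proof. by apply: measurable_funB. Qed.

Let shift_back t (x : R) : R := x - t.

Let measurable_shift_back t : measurable_fun setT (shift_back t).
Proof. exact: measurable_funB. Qed.

Definition arrival_meas t : {measure set (RR * R) -> \bar R} := (time_meas t \x al)%E.

Lemma arrival_meas_setT t : (arrival_meas t setT < +oo)%E.
Proof.
rewrite -setXTT /arrival_meas/= product_measure1E// ltey_eq fin_numM//.
- exact: fin_num_measure.
- exact: fin_num_measure.
Qed.

Lemma arrival_integrable t (f : RR * R -> R) M : measurable_fun setT f ->
  (forall z, `|f z| <= M) -> (arrival_meas t).-integrable setT (EFin \o f).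
Proof.
move=> mf fM; apply: measurable_bounded_integrable => //.
  exact: arrival_meas_setT.
by exists M; split => [|r Mr x _]; [exact: num_real | exact: le_trans (fM x) (ltW Mr)].
Qed.

Section Fubini.
Variables (t : R) (f : R -> R) (M : R).
Hypotheses (mf : measurable_fun setT f) (fM : forall x, `|f x| <= M).

Let mfd : measurable_fun setT (f \o diff).
Proof. exact: (measurableT_comp mf measurable_diff). Qed.

Let mfs (s : R) : measurable_fun setT (fun x : R => f (x - s)).
Proof. exact: (measurableT_comp mf (measurable_shift_back s)). Qed.

Let EFin_pairing s : (pairing al (fun x => f (x - s)))%:E = (\int[al]_x (f (x - s)%R)%:E)%E.
Proof.
rewrite /pairing fineK//; apply: integrable_fin_num => //.
exact: (@bounded_integrable _ _ _ al _ _ M).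
Qed.

Lemma measurable_pairing_shift : measurable_fun setT (fun s : RR => pairing al (fun x => f (x - s))).
Proof.
(* Only the measurability of the inner integral is extracted from Fubini's theorem; the time 0 in
   the first marginal is an arbitrary choice. *)
have int := arrival_integrable 0 mfd (fun z => fM _).
have := measurable_fubini_F int; rewrite /fubini_F => mF.
apply/measurable_EFinP; apply: eq_measurable_fun mF => s _ /=.
by rewrite EFin_pairing.
Qed.

Lemma pairing_shift_le s : `|pairing al (fun x => f (x - s))| <= M.
Proof.
have := le_norm_pairing al (mfs s) (fun x => fM _).
have -> : mass al = 1 := congr1 fine (probability_setT al).
by rewrite mulr1.
Qed.

Lemma arrival_fubini : (\int[arrival_meas t]_z (f (diff z))%:E)%E =
  (\int[lebesgue_measure]_(s in `[0%R, t]%classic)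
     (pairing al (fun x => f (x - s)))%:E)%E.
Proof.
rewrite -(integral_time_meas t measurable_pairing_shift pairing_shift_le).
rewrite /arrival_meas -(integral12_prod_meas1 (arrival_integrable t mfd (fun z => fM _))).
by apply: eq_integral => s _; rewrite EFin_pairing.
Qed.

End Fubini.

Hypothesis lam0 : 0 <= lam.

Let push_shift (t : R) : {measure set R -> \bar R}.
Proof.
refine (pushforward mu (shift_back t) : {measure set R -> \bar R}).
exact: measurable_shift_back.
Defined.

Let push_arrival (t : R) : {measure set R -> \bar R}.
Proof.
refine (pushforward (arrival_meas t) diff : {measure set R -> \bar R}).
exact: measurable_diff.
Defined.

(** The same set function assembled from push-forwards, to which the change of variables and the
    additivity of the integral apply. *)
Let fluid_measure t : {measure set R -> \bar R} :=
  measure_add (push_shift t) (mscale (NngNum lam0) (push_arrival t)).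

Let fluid_measureE t B : measurable B -> fluid_limit t B = fluid_measure t B.
Proof. by move=> mB; symmetry; exact: measure_addE. Qed.

Lemma fluid_limit_fin_meas t : fin_meas (fluid_limit t).
Proof.
apply: (measure_fin_meas (@fluid_measureE t)).
rewrite -fluid_measureE// /fluid_limit.
have -> : [set x : R | [set: R] (x - t)] = setT by apply/seteqP.
have -> : [set z : RR * R | [set: R] (z.2 - z.1)] = setT by apply/seteqP.
rewrite lte_add_pinfty//; first by rewrite -ge0_fin_numE// fin_num_measure.
by rewrite lte_mul_pinfty//; exact: arrival_meas_setT.
Qed.

Lemma integral_mscale_EFin (nu : {measure set R -> \bar R}) (k : {nonneg R}) (f : R -> \bar R) :
  nu.-integrable setT f ->
  (\int[mscale k nu]_x f x = k%:num%:E * \int[nu]_x f x)%E.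
Proof.
move=> intf; have mf := measurable_int nu intf.
rewrite integralE [in RHS]integralE.
rewrite !ge0_integral_mscale//; [|exact: measurable_funeneg|exact: measurable_funepos].
have h : (\int[nu]_x f^\+ x +? - \int[nu]_x f^\- x)%E by exact: integrable_add_def.
by symmetry; apply: muleBr.
Qed.

Lemma pairing_fluid_limit t (f : R -> R) (M : R) : measurable_fun setT f ->
  (forall x, `|f x| <= M) ->
  pairing (fluid_limit t) f = pairing mu (fun x => f (x - t)) +
    lam * fine (\int[lebesgue_measure]_(s in `[0%R, t]%classic)
      (pairing al (fun x => f (x - s)))%:E)%E.
Proof.
move=> mf fM.
have intd : (arrival_meas t).-integrable setT (EFin \o (f \o diff)).
  exact: (arrival_integrable t (measurableT_comp mf measurable_diff) (fun z => fM _)).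
have ints : mu.-integrable setT (EFin \o (f \o shift_back t)).
  apply: (@bounded_integrable _ _ _ mu _ _ M) => //.
    exact: (measurableT_comp mf (measurable_shift_back t)).
  by move=> x _; exact: fM.
have mEf : measurable_fun setT (EFin \o f) by exact/measurable_EFinP.
have int1 : (push_shift t).-integrable setT (EFin \o f).
  exact: (integrable_pushforward (measurable_shift_back t) mEf ints).
have int2 : (push_arrival t).-integrable setT (EFin \o f).
  exact: (integrable_pushforward measurable_diff mEf intd).
have int3 : (mscale (NngNum lam0) (push_arrival t)).-integrable setT (EFin \o f).
  apply/integrableP; split=> //.
  rewrite ge0_integral_mscale//; last exact: measurableT_comp.
  by rewrite lte_mul_pinfty//; case/integrableP: int2.
have F1 : (\int[mu]_x (f (x - t)%R)%:E)%E \is a fin_num.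
  exact: (integrable_fin_num measurableT ints).
have F2 : (\int[arrival_meas t]_z (f (diff z))%:E)%E \is a fin_num.
  exact: (integrable_fin_num measurableT intd).
have E1 : (\int[fluid_measure t]_x (EFin \o f) x = \int[mu]_x (f (x - t)%R)%:E +
    lam%:E * \int[arrival_meas t]_z (f (diff z))%:E)%E.
  rewrite (integral_measure_add measurableT int1 int3); congr (_ + _)%E.
    exact: (integral_pushforward (measurable_shift_back t) mEf ints).
  rewrite integral_mscale_EFin//; congr (_ * _)%E.
  exact: (integral_pushforward measurable_diff mEf intd).
rewrite (eq_pairing f (@fluid_measureE t)) /pairing E1 -(arrival_fubini t mf fM).
by rewrite fineD ?fin_numM// fineM.
Qed.

Lemma pairing_shift_continuous (nu : {finite_measure set R -> \bar R}) (f : R -> R) :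
  Cb f -> continuous (fun t => pairing nu (fun x => f (x - t))).
Proof.
move=> [cf [M fM]] t.
have mf : measurable_fun setT f by exact: continuous_measurable_fun.
have tI : t \in `]t - 1, t + 1[%classic.
  by rewrite inE/= in_itv/=; apply/andP; split; lra.
have intf s : nu.-integrable setT (EFin \o (fun x => f (x - s))).
  apply: (@bounded_integrable _ _ _ nu _ _ M) => //.
  exact: (measurableT_comp mf (measurable_shift_back s)).
have intM : nu.-integrable setT (EFin \o cst M).
  by apply: (@bounded_integrable _ _ _ nu _ _ `|M|).
apply: (@continuity_under_integral R _ _ nu (fun s x => f (x - s)) setT measurableT
  (t - 1) (t + 1) _ _ (cst M) intM _ t tI) => [s _|| s _].
- exact: intf.
- apply: aeW => y _ s _; apply: (@continuous_comp _ _ _ (fun u : R => y - u) f); last exact: cf.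
  by apply: cvgB; [exact: cvg_cst | exact: cvg_id].
- by apply: aeW => y _; exact: fM.
Qed.

(** The initial part is continuous by dominated convergence. The arrival part integrates a function
    bounded by [M] over [[0, t]], hence is [M]-Lipschitz; for [t < 0] the interval is empty and the
    integral is 0, so continuity extends to the whole line. *)
Lemma pairing_fluid_limit_continuous (f : R -> R) :
  Cb f -> continuous (fun t => pairing (fluid_limit t) f).
Proof.
move=> Cbf; have [cf [M fM]] := Cbf.
have mf : measurable_fun setT f by exact: continuous_measurable_fun.
have M0 : 0 <= M by rewrite (le_trans _ (fM 0)).
pose g s := pairing al (fun x => f (x - s)).
have mg : measurable_fun setT (g : RR -> R) by exact: measurable_pairing_shift mf fM.
have gM s : `|g s| <= M by exact: pairing_shift_le.
have intg t : lebesgue_measure.-integrable `[0%R, t]%classic (EFin \o (g : RR -> R)).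
  apply: measurable_bounded_integrable => //.
  - exact: leb_itv_lty.
  - exact: measurable_funTS.
  - by exists M; split => [|r Mr x _]; [exact: num_real | exact: le_trans (gM x) (ltW Mr)].
pose h t := \int[lebesgue_measure]_(s in `[0%R, t]%classic) (g : RR -> R) s.
have hneg t : t < 0 -> h t = 0.
  by move=> t0; rewrite /h set_itv_ge ?Rintegral_set0// bnd_simp -ltNge.
have hint t u : 0 <= t <= u -> `|h u - h t| <= M * (u - t).
  move=> /andP[t0 tu]; rewrite /h Rintegral_itvB//=.
  have intgu : lebesgue_measure.-integrable `]t, u]%classic (EFin \o (g : RR -> R)).
    apply: integrableS (intg u) => // x /=; rewrite !in_itv/= => /andP[tx ->].
    by rewrite (le_trans t0 (ltW tx)).
  apply: le_trans (le_normr_Rintegral _ intgu) _ => //.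
  have -> : M * (u - t) = \int[lebesgue_measure]_(s in `]t, u]%classic) (cst M : RR -> R) s.
    rewrite Rintegral_cst//= lebesgue_measure_itv/= lte_fin; congr (_ * _).
    by move: tu; rewrite le_eqVlt => /predU1P[->|->]//; rewrite ltxx subrr.
  apply: le_Rintegral => //; first exact: integrable_norm.
  apply: measurable_bounded_integrable => //.
    by rewrite /= lebesgue_measure_itv/=; case: ifP => _; rewrite ?ltry// -EFinB ltry.
  by exists M; split => [|r Mr x _]; [exact: num_real | rewrite /= ger0_norm// ltW].
have hlip t u : t <= u -> `|h u - h t| <= M * (u - t).
  move=> tu; have [t0|t0] := leP 0 t; first by rewrite hint// t0.
  have [u0|u0] := leP 0 u; last by rewrite !hneg// subrr normr0 mulr_ge0// subr_ge0.
  have h0 : h 0 = 0.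
    by rewrite /h set_itv1 Rintegral_set1.
  rewrite (hneg t t0) -h0 (le_trans (hint 0 u _)) ?lexx//.
  by rewrite ler_wpM2l// lerB// ltW.
have ch : continuous h.
  move=> t; apply/cvgrPdist_le => e e0.
  have M1 : 0 < M + 1 by rewrite ltr_wpDl.
  near=> u.
  have : `|t - u| <= e / (M + 1).
    by near: u; apply: cvgr_dist_le; [exact: cvg_id | rewrite divr_gt0].
  rewrite ler_pdivlMr// => tu.
  have : `|h t - h u| <= M * `|t - u|.
    have [tlu|utl] := leP t u; first by rewrite distrC (distrC t u) (ger0_norm (_ : 0 <= u - t)) ?subr_ge0// hlip.
    by rewrite (ger0_norm (_ : 0 <= t - u)) ?subr_ge0 ?(ltW utl)// hlip// ltW.
  move/le_trans; apply; apply: le_trans tu.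
  by rewrite mulrC ler_wpM2l// lerDl.
have -> : (fun t => pairing (fluid_limit t) f) =
    (fun t => pairing mu (fun x => f (x - t)) + lam * h t).
  by apply/funext => t; rewrite (pairing_fluid_limit t mf fM).
move=> t; apply: cvgD; first exact: pairing_shift_continuous.
by apply: cvgM; [exact: cvg_cst | exact: ch].
Unshelve. all: end_near. Qed.

End Limit.

(** * Service tails integrated over the arrival time *)

Section TailIntegral.
Variables (R : realType) (al : probability R R).

Lemma tail_ge0 (nu : {measure set R -> \bar R}) c : 0 <= tail nu c.
Proof. by rewrite /tail fine_ge0. Qed.

Lemma tail_anti (nu : {finite_measure set R -> \bar R}) (c c' : R) : c <= c' ->
  tail nu c' <= tail nu c.
Proof.
move=> cc'; rewrite /tail fine_le ?fin_num_measure//.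
by apply: le_measure; rewrite ?inE// => x /=; rewrite !in_itv/= !andbT; exact: le_trans.
Qed.

Lemma tail_le_mass (nu : {finite_measure set R -> \bar R}) (c : R) : tail nu c <= mass nu.
Proof.
by rewrite /tail fine_le ?fin_num_measure//; apply: le_measure; rewrite ?inE.
Qed.

Lemma mass_prob : mass al = 1.
Proof. exact (congr1 fine (probability_setT al)). Qed.

Lemma tail_prob_le1 c : tail al c <= 1.
Proof. by rewrite -mass_prob tail_le_mass. Qed.

(** Here [s] is the time since arrival. A customer arrived at [t - s] leaves at [a] or later exactly
    when its service is at least [a - t + s]. With [u = t - s] this is the integral of
    [tail al (a - u)] over arrival times [u] in [[0, t]]. *)
Definition tail_integral (a t : R) : R :=
  fine (\int[lebesgue_measure]_(s in `[0%R, t]%classic) (tail al (a - t + s))%:E)%E.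

Let k (c : R) : measurableTypeR R -> R := fun s => tail al (c + s).

Let kE c s : k c s = pairing al (fun x => \1_`[c, +oo[ (x - s)).
Proof.
rewrite /k (_ : (fun x => _) = \1_`[c + s, +oo[).
  by rewrite pairing_indic.
by apply/funext => x; rewrite !indic_ray lerBrDr.
Qed.

Lemma measurable_tail_shift c : measurable_fun setT (k c).
Proof.
rewrite (_ : k c = fun s => pairing al (fun x => \1_`[c, +oo[ (x - s))); last first.
  by apply/funext => s; exact: kE.
apply: (@measurable_pairing_shift _ al _ 1) => // x.
by rewrite indic_ray; case: (c <= x); rewrite ?normr0 ?normr1.
Qed.

Let k_integrable c (D : set (measurableTypeR R)) : measurable D ->
  (lebesgue_measure D < +oo)%E -> lebesgue_measure.-integrable D (EFin \o k c).
Proof.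
move=> mD Doo; apply: measurable_bounded_integrable => //.
  apply: measurable_funTS; exact: measurable_tail_shift.
exists 1; split => [|r r1 x _]; first exact: num_real.
suff : `|k c x| <= r by [].
by rewrite ger0_norm ?tail_ge0// (le_trans (tail_prob_le1 _))// ltW.
Qed.

Lemma lebesgue_itv_fin (b1 b2 : bool) (u v : R) :
  (lebesgue_measure [set` Interval (BSide b1 u) (BSide b2 v)] < +oo)%E.
Proof.
by rewrite lebesgue_measure_itv/=; case: ifP => _; rewrite ?ltry// -EFinB ltry.
Qed.

Let cell c u v : 0 <= u -> u <= v ->
  (v - u) * tail al (c + v) <=
  \int[lebesgue_measure]_(s in `[0%R, v]%classic) k c s -
  \int[lebesgue_measure]_(s in `[0%R, u]%classic) k c s <=
  (v - u) * tail al (c + u).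
Proof.
move=> u0 uv; rewrite Rintegral_itvB//=; last first.
  by apply: k_integrable => //; exact: lebesgue_itv_fin.
have mE (r : R) : \int[lebesgue_measure]_(s in `]u, v]%classic) (cst r : measurableTypeR R -> R) s = (v - u) * r.
  rewrite Rintegral_cst//= lebesgue_measure_itv/= lte_fin mulrC; congr (_ * _).
  by move: uv; rewrite le_eqVlt => /predU1P[->|->]//; rewrite ltxx subrr.
have intr (r : R) : lebesgue_measure.-integrable (`]u, v]%classic : set (measurableTypeR R))
    (EFin \o (cst r : measurableTypeR R -> R)).
  apply: measurable_bounded_integrable => //; first exact: lebesgue_itv_fin.
  by exists `|r|; split => [|x Mr y _]; [exact: num_real | exact: ltW].
have intk : lebesgue_measure.-integrable (`]u, v]%classic : set (measurableTypeR R)) (EFin \o k c).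
  by apply: k_integrable => //; exact: lebesgue_itv_fin.
by rewrite -!mE; apply/andP; split; apply: le_Rintegral => // x /=;
  rewrite in_itv/= => /andP[ux xv]; rewrite /k tail_anti// lerD2l// ltW.
Qed.

Lemma tail_integral_riemann (a t h : R) (L : nat) : 0 < h -> L%:R * h <= t < L.+1%:R * h ->
  h * \sum_(l < L) tail al (a - l%:R * h) <= tail_integral a t <=
  h * (\sum_(l < L) tail al (a - l.+1%:R * h) + 1).
Proof.
move=> h0 /andP[Lt tL].
(* Times since arrival up to [t - l h] are arrival times from [l h] on. Thus [J l - J l.+1] belongs
   to the arrival cell from [l h] to [l.+1 h], on which the tail is monotone; the last, incomplete
   cell contributes between 0 and [h]. *)
pose J l := \int[lebesgue_measure]_(s in `[0%R, t - l%:R * h]%classic) k (a - t) s.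
have step l : (l < L)%N -> h * tail al (a - l%:R * h) <= J l - J l.+1 <=
    h * tail al (a - l.+1%:R * h).
  move=> lL.
  have l1 : 0 <= t - l.+1%:R * h.
    by rewrite subr_ge0 (le_trans _ Lt)// ler_wpM2r ?ler_nat// ltW.
  have l2 : t - l.+1%:R * h <= t - l%:R * h.
    by rewrite lerD2l lerN2 ler_wpM2r ?ler_nat// ltW.
  have := cell (a - t) l1 l2; rewrite -/(J l) -/(J l.+1).
  have -> : t - l%:R * h - (t - l.+1%:R * h) = h by rewrite -natr1; ring.
  by rewrite !(addrA (a - t)) !subrK.
have JL0 : 0 <= J L by apply: Rintegral_ge0 => x _; exact: tail_ge0.
have JLh : J L <= h.
  have tL0 : 0 <= t - L%:R * h by rewrite subr_ge0.
  have /andP[_] := cell (a - t) (lexx 0) tL0.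
  rewrite -/(J L) set_itv1 Rintegral_set1 !subr0 => /le_trans; apply.
  rewrite (le_trans (_ : _ <= (t - L%:R * h) * 1))//.
    by rewrite ler_wpM2l// tail_prob_le1.
  by move: tL; rewrite mulr1 -natr1 mulrDl mul1r; lra.
have J0 : tail_integral a t = J 0%N by rewrite /tail_integral /J mul0r subr0.
have tele : J 0%N = \sum_(l < L) (J l - J l.+1) + J L.
  elim: L {Lt tL step JL0 JLh} => [|L IH]; first by rewrite big_ord0 add0r.
  by rewrite big_ord_recr/= IH; ring.
rewrite J0 tele mulrDr mulr1 !mulr_sumr; apply/andP; split.
  rewrite ler_wpDr//; apply: ler_sum => i _.
  by have /andP[] := step i (ltn_ord i).
rewrite lerD//; apply: ler_sum => i _.
by have /andP[] := step i (ltn_ord i).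
Qed.

End TailIntegral.

(** * Counting departures by blocks of arrivals *)

Section Counting.
Variables (R : realType) (N : R) (E sig : nat -> R) (idx : nat -> nat).
Hypotheses (N0 : 0 < N) (E0 : forall i, 0 <= E i).
Hypotheses (idx0 : idx 0 = 0%N) (idxS : {homo idx : l l' / (l <= l')%N >-> (l <= l')%N}).

Let T i := \sum_(j < i.+1) E j.
(** [S l] is the rescaled time at which the first [l] blocks have arrived; [V l c] is the normalized
    number of their customers whose service is at least [N c]. *)
Let S l := N^-1 * \sum_(j < idx l) E j.
Let V l c := N^-1 * \sum_(i < idx l) (N * c <= sig i)%R%:R.

(** [K] makes the count a finite sum. The count is complete as soon as every customer of index at
    least [K] arrives after [N t]. *)
Definition departures_after K (t a : R) : R :=
  N^-1 * \sum_(i < K) ((T i <= N * t) && (N * a <= T i + sig i))%R%:R.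

Let sumE_mono m n : (m <= n)%N -> \sum_(j < m) E j <= \sum_(j < n) E j.
Proof.
move=> mn; rewrite -!(big_mkord xpredT E) (@big_cat_nat _ _ _ m 0 n)//=.
by rewrite lerDl sumr_ge0.
Qed.

Let sum_blocks (F : nat -> R) L :
  \sum_(i < idx L) F i = \sum_(l < L) \sum_(idx l <= i < idx l.+1) F i.
Proof.
elim: L => [|L IH]; first by rewrite idx0 !big_ord0.
rewrite big_ord_recr/= -IH -!(big_mkord xpredT F) [LHS](@big_cat_nat _ _ _ (idx L))//.
exact: idxS.
Qed.

Let block_count l c :
  \sum_(idx l <= i < idx l.+1) (N * c <= sig i)%R%:R = N * (V l.+1 c - V l c).
Proof.
rewrite /V -mulrBr mulrA divff ?gt_eqF// mul1r.
rewrite -!(big_mkord xpredT (fun i => (N * c <= sig i)%R%:R)).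
by rewrite (@big_cat_nat _ _ _ (idx l) 0 (idx l.+1))//=; [rewrite addrAC subrr add0r|exact: idxS].
Qed.

Variables (h : R) (L0 : nat).
Hypotheses (h0 : 0 < h).
Hypothesis Sh : forall l, (l <= L0)%N -> `|S l - l%:R * h| <= h.

Let T_lb l i : (l <= L0)%N -> (idx l <= i)%N -> N * ((l%:R - 1) * h) <= T i.
Proof.
move=> lL li; apply: le_trans (sumE_mono (leqW li)).
rewrite -ler_pdivlMl//; have := Sh lL; rewrite /S ler_norml => /andP[+ _].
by rewrite mulrBl mul1r; lra.
Qed.

(** A customer of block [l] has arrived by the end [S l.+1] of its block; one further [h] is the
    error allowed by [Sh]. *)
Let T_ub l i : (l < L0)%N -> (i < idx l.+1)%N -> T i <= N * ((l%:R + 2) * h).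
Proof.
move=> lL li; apply: le_trans (sumE_mono li) _.
rewrite -ler_pdivrMl//; have := Sh lL; rewrite /S ler_norml => /andP[_ +].
by rewrite -natr1 !mulrDl mul1r; lra.
Qed.

Lemma arrival_after_horizon (Tm : R) i : Tm < (L0%:R - 1) * h -> (idx L0 <= i)%N ->
  N * Tm < T i.
Proof.
move=> TL li; apply: lt_le_trans (T_lb (leqnn L0) li).
by rewrite ltr_pM2l.
Qed.

(** A customer of block [l] has arrived by [N (l + 2) h], so a departure at [N a] or later forces a
    service of at least [N (a - (l + 2) h)]. The blocks from [L.+2] on start at [N L.+1 h] or later,
    hence after [N t], and contribute nothing. *)
Let departures_ub (t a : R) L : (L.+2 <= L0)%N -> t < L.+1%:R * h ->
  departures_after (idx L0) t a <=
  \sum_(l < L.+2) (V l.+1 (a - (l%:R + 2) * h) - V l (a - (l%:R + 2) * h)).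
Proof.
move=> LL tL; pose F i : R := ((T i <= N * t) && (N * a <= T i + sig i))%R%:R.
have -> : departures_after (idx L0) t a = N^-1 * \sum_(i < idx L0) F i by [].
rewrite (sum_blocks F) ler_pdivrMl// mulr_sumr.
rewrite -!(big_mkord xpredT (fun l => \sum_(idx l <= i < idx l.+1) F i)).
rewrite (@big_cat_nat _ _ _ L.+2 0 L0)//=.
have -> : \sum_(L.+2 <= l < L0) \sum_(idx l <= i < idx l.+1) F i = 0.
  rewrite big_nat_cond big1// => l; rewrite andbT => /andP[Ll lL].
  rewrite big_nat_cond big1// => i; rewrite andbT => /andP[li _].
  rewrite /F; suff -> : (T i <= N * t) = false by [].
  apply/negbTE; rewrite -ltNge (lt_le_trans _ (T_lb LL (leq_trans (idxS Ll) li)))//.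
  rewrite ltr_pM2l// (lt_le_trans tL)// ler_pM2r// -[L.+2%:R]natr1; lra.
rewrite addr0 big_mkord; apply: ler_sum => l _; rewrite -block_count.
apply: ler_sum_nat => i /andP[_ li].
rewrite /F ler_nat; case: (T i <= N * t) => //=.
case: leP => //= aT; suff -> : N * (a - (l%:R + 2) * h) <= sig i by [].
have := T_ub (leq_trans (ltn_ord l) LL) li; rewrite mulrBr; lra.
Qed.

(** A customer of block [l] arrives at [N (l - 1) h] or later, so a service of at least
    [N (a - (l - 1) h)] makes it depart at [N a] or later. The blocks [l < L.-1] are complete by
    [(l + 2) h <= L h <= t]; the remaining ones are dropped. *)
Let departures_lb (t a : R) L : (L.+2 <= L0)%N -> L%:R * h <= t ->
  \sum_(l < L.-1) (V l.+1 (a - (l%:R - 1) * h) - V l (a - (l%:R - 1) * h)) <=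
  departures_after (idx L0) t a.
Proof.
move=> LL Lt; pose F i : R := ((T i <= N * t) && (N * a <= T i + sig i))%R%:R.
have -> : departures_after (idx L0) t a = N^-1 * \sum_(i < idx L0) F i by [].
rewrite (sum_blocks F) ler_pdivlMl// mulr_sumr.
rewrite -[leRHS](big_mkord xpredT (fun l => \sum_(idx l <= i < idx l.+1) F i)).
have LL0 : (L.-1 <= L0)%N by rewrite (leq_trans (leq_pred _))// ltnW// ltnW.
rewrite (@big_cat_nat _ _ _ L.-1 0 L0)//= ler_wpDr//.
  by apply: sumr_ge0 => l _; apply: sumr_ge0.
rewrite big_mkord; apply: ler_sum => l _; rewrite -block_count.
apply: ler_sum_nat => i /andP[il li].
rewrite /F ler_nat; case: leP => //= sc.
have lL0 : (l < L0)%N := leq_trans (ltn_ord l) LL0.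
have -> : T i <= N * t.
  apply: le_trans (T_ub lL0 li) _; rewrite ler_pM2l// (le_trans _ Lt)// ler_pM2r//.
  have : (l.+2 <= L)%N by have := ltn_ord l; rewrite ltn_predRL.
  by rewrite -(ler_nat R) -natr1 -natr1; lra.
suff -> : N * a <= T i + sig i by [].
have := T_lb (ltnW lL0) il; move: sc; rewrite mulrBr; lra.
Qed.

Variables (al : probability R R) (lam eta a Tm : R).
Hypotheses (lam0 : 0 <= lam) (eta0 : 0 <= eta).
Hypothesis Vh : forall l m, (l <= L0)%N -> (m <= L0 + 3)%N ->
  `|V l (a - (m%:R - 1) * h) - lam * (l%:R * h) * tail al (a - (m%:R - 1) * h)| <= eta.
Hypothesis TmL : Tm < (L0%:R - 1) * h.

(** The offset in [m - 1] lets natural indices cover all shifts in use: [m = l] is the shift of the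
    lower bound on block [l], and [m = l + 3] that of the upper bound. *)
Let g m := tail al (a - (m%:R - 1) * h).

Let Vdiff l m : (l < L0)%N -> (m <= L0 + 3)%N ->
  `|V l.+1 (a - (m%:R - 1) * h) - V l (a - (m%:R - 1) * h) - lam * h * g m| <= 2 * eta.
Proof.
move=> lL mL; have := Vh lL mL; have := Vh (ltnW lL) mL.
rewrite -/(g m); set v := V l _; set v' := V l.+1 _.
rewrite -natr1 !ler_norml => /andP[? ?] /andP[? ?]; apply/andP; split; lra.
Qed.

Let g_range m : 0 <= g m <= 1.
Proof. by rewrite tail_ge0 tail_prob_le1. Qed.

(** The two bounds and the two Riemann sums are sums of the same sequence [g], displaced by a few
    indices. As [0 <= g <= 1], the displacement costs at most 4 cells of weight [lam * h]; each of
    at most [L0] blocks adds [2 * eta]. *)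
Lemma departures_close (t : R) : 0 <= t <= Tm ->
  `|departures_after (idx L0) t a - lam * tail_integral al a t| <=
  4 * lam * h + 2 * eta * L0%:R.
Proof.
move=> /andP[t0 tT].
pose L := Num.truncn (t / h).
have th0 : 0 <= t / h by rewrite divr_ge0// ltW.
have /andP[L1 L2] := truncn_itv th0.
rewrite -/L ler_pdivlMr// in L1; rewrite -/L ltr_pdivrMr// in L2.
have LL : (L.+2 <= L0)%N.
  have : L%:R * h < (L0%:R - 1) * h by rewrite (le_lt_trans L1)// (le_lt_trans tT).
  by rewrite ltr_pM2r// ltrBrDr natr1 ltr_nat.
have /andP[R1 R2] : h * \sum_(l < L) g l.+1 <= tail_integral al a t <=
    h * (\sum_(l < L) g l.+2 + 1).
  have := tail_integral_riemann al a h0 (introT andP (conj L1 L2)).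
  rewrite (eq_bigr (fun l : 'I_L => g l.+1)) => [|l _]; last by rewrite /g -natr1 addrK.
  by rewrite [X in _ * (X + 1)](eq_bigr (fun l : 'I_L => g l.+2)) => [|l _]; last by rewrite /g -[l.+2%:R]natr1 addrK.
have ub := departures_ub a LL L2; have lb := departures_lb a LL L1.
have eub : \sum_(l < L.+2) (V l.+1 (a - (l%:R + 2) * h) - V l (a - (l%:R + 2) * h)) <=
    lam * h * \sum_(l < L.+2) g (l + 3) + 2 * eta * L0%:R.
  rewrite mulr_sumr (le_trans (_ : _ <= \sum_(l < L.+2) (lam * h * g (l + 3) + 2 * eta)))//.
    apply: ler_sum => l _.
    have lL0 : (l < L0)%N := leq_trans (ltn_ord l) LL.
    have mL : (l + 3 <= L0 + 3)%N by rewrite leq_add2r ltnW.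
    have := Vdiff lL0 mL.
    have -> : ((l + 3)%:R - 1 : R) = l%:R + 2 by rewrite natrD; ring.
    by rewrite ler_norml => /andP[_]; lra.
  rewrite big_split/= lerD2l sumr_const card_ord -[leLHS]mulr_natr.
  by rewrite ler_wpM2l ?mulr_ge0// ler_nat.
have elb : lam * h * \sum_(l < L.-1) g l - 2 * eta * L0%:R <=
    \sum_(l < L.-1) (V l.+1 (a - (l%:R - 1) * h) - V l (a - (l%:R - 1) * h)).
  have LL0 : (L.-1 <= L0)%N by rewrite (leq_trans (leq_pred _))// ltnW// ltnW.
  rewrite lerBlDr mulr_sumr.
  rewrite (le_trans (_ : _ <= \sum_(l < L.-1) (V l.+1 (a - (l%:R - 1) * h) - V l (a - (l%:R - 1) * h) + 2 * eta)))//.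
    apply: ler_sum => l _.
    have lL0 : (l < L0)%N := leq_trans (ltn_ord l) LL0.
    have mL : (l <= L0 + 3)%N by rewrite (leq_trans (ltnW lL0))// leq_addr.
    by have := Vdiff lL0 mL; rewrite ler_norml => /andP[+ _]; lra.
  rewrite big_split/= lerD2l sumr_const card_ord -[leLHS]mulr_natr.
  by rewrite ler_wpM2l ?mulr_ge0// ler_nat.
have s1 : \sum_(l < L.+2) g (l + 3) <= \sum_(l < L) g l.+1 + 4.
  have e M : \sum_(l < M.+2) g (l + 3) + g 1%N + g 2%N =
      \sum_(l < M) g l.+1 + g M.+1 + g M.+2 + g M.+3 + g M.+4.
    elim: M => [|M IH]; first by rewrite big_ord0 !big_ord_recr big_ord0 /=; ring.
    rewrite big_ord_recr [in RHS]big_ord_recr/=.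
    have -> : (M.+2 + 3 = M.+1.+4)%N by rewrite addnC.
    by move: IH; lra.
  have := e L; have := g_range 1; have := g_range 2; have := g_range L.+1.
  have := g_range L.+2; have := g_range L.+3; have := g_range L.+4.
  by do 6 (move=> /andP[? ?]); lra.
(* The missing fourth cell of the lower bound is the incomplete one, the [+ 1] in [R2]. *)
have s2 : \sum_(l < L) g l.+2 <= \sum_(l < L.-1) g l + 3.
  case: (L) => [|M]; first by rewrite !big_ord0; lra.
  have e : \sum_(l < M.+1) g l.+2 + g 0%N + g 1%N = \sum_(l < M) g l + g M + g M.+1 + g M.+2.
    elim: M => [|M IH]; first by rewrite big_ord_recr !big_ord0 /=; ring.
    by rewrite big_ord_recr [in RHS]big_ord_recr/=; move: IH; lra.
  have := g_range 0; have := g_range 1; have := g_range M.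
  have := g_range M.+1; have := g_range M.+2; move: e => /=.
  by move=> ? /andP[? ?] /andP[? ?] /andP[? ?] /andP[? ?] /andP[? ?]; lra.
have lh : 0 <= lam * h by rewrite mulr_ge0// ltW.
have := ler_wpM2l lam0 R1; have := ler_wpM2l lam0 R2.
have := ler_wpM2l lh s1; have := ler_wpM2l lh s2.
move: ub lb eub elb; set A := departures_after _ _ _; set B := tail_integral _ _ _.
move=> ub lb eub elb h1 h2 h3 h4.
rewrite ler_norml; apply/andP; split; lra.
Qed.

End Counting.

(** * Paths of the normalized profile *)

Section FiniteMeasureOperations.
Variable R : realType.
Implicit Types (mu nu : {finite_measure set R -> \bar R}) (f g : R -> R).

Lemma cvg_rsum (F : set_system R) {FF : ProperFilter F} K (h : nat -> R -> R) (l : nat -> R) :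
  (forall i, h i s @[s --> F] --> l i) ->
  \sum_(i < K) h i s @[s --> F] --> \sum_(i < K) l i.
Proof.
move=> hl; elim: K => [|K IH].
  by rewrite big_ord0 (_ : (fun s => _) = cst 0); [exact: cvg_cst | apply/funext => s; rewrite big_ord0].
rewrite big_ord_recr/= (_ : (fun s => _) = fun s => \sum_(i < K) h i s + h K s).
  exact: cvgD.
by apply/funext => s; rewrite big_ord_recr.
Qed.

Definition bounded_meas f : Prop :=
  measurable_fun setT f /\ exists M : R, forall x, `|f x| <= M.

Lemma bounded_meas_integrable mu f : bounded_meas f -> mu.-integrable setT (EFin \o f).
Proof. by move=> [mf [M fM]]; exact: (@bounded_integrable _ _ _ mu _ _ M). Qed.

Lemma Cb_bounded_meas f : Cb f -> bounded_meas f.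
Proof. by move=> [cf bf]; split => //; exact: continuous_measurable_fun. Qed.

Lemma bounded_meas_comp f g : bounded_meas f -> measurable_fun setT g ->
  bounded_meas (fun x => f (g x)).
Proof.
move=> [mf [M fM]] mg; split; last by exists M.
exact: (measurableT_comp mf mg).
Qed.

(** Push-forward, scaling, sum and added atoms are each packaged as a finite measure known through
    two formulas, its values on Borel sets and its pairings. The profile at a fixed time is composed
    from these four operations. *)
Lemma ex_pushforward mu g : measurable_fun setT g -> exists nu,
  (forall B, measurable B -> nu B = mu (g @^-1` B)) /\
  (forall f, bounded_meas f -> pairing nu f = pairing mu (fun x => f (g x))).
Proof.
move=> mg.
have @rho : {measure set R -> \bar R}.
  by refine (pushforward mu g : {measure set R -> \bar R}); exact: mg.
have rhoE B : measurable B -> pushforward mu g B = rho B by [].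
have rhoT : (rho setT < +oo)%E.
  by rewrite -rhoE// /pushforward preimage_setT -ge0_fin_numE// fin_num_measure.
have [nu nuE] := fin_meas_finite (measure_fin_meas rhoE rhoT).
exists nu; split => [B mB|f bf]; first by rewrite -nuE.
rewrite -(eq_pairing f nuE); congr fine.
rewrite (integral_pushforward mg)//; first by apply/measurable_EFinP; case: bf.
exact: (bounded_meas_integrable mu (bounded_meas_comp bf mg)).
Qed.

Lemma ex_mscale mu (c : R) : 0 <= c -> exists nu,
  (forall B, measurable B -> nu B = (c%:E * mu B)%E) /\
  (forall f, bounded_meas f -> pairing nu f = c * pairing mu f).
Proof.
move=> c0; pose rho : {measure set R -> \bar R} := mscale (NngNum c0) mu.
have rhoE B : measurable B -> (fun B => (c%:E * mu B)%E) B = rho B by [].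
have rhoT : (rho setT < +oo)%E.
  by rewrite /rho/= /mscale lte_mul_pinfty// -ge0_fin_numE// fin_num_measure.
have [nu nuE] := fin_meas_finite (measure_fin_meas rhoE rhoT).
exists nu; split => [B mB|f bf]; first by rewrite -nuE.
have intf := bounded_meas_integrable mu bf.
rewrite -(eq_pairing f nuE) (eq_pairing f rhoE) /pairing (integral_mscale_EFin _ intf)/= fineM//.
exact: (integrable_fin_num measurableT intf).
Qed.

Lemma ex_add mu1 mu2 : exists nu,
  (forall B, measurable B -> nu B = (mu1 B + mu2 B)%E) /\
  (forall f, bounded_meas f -> pairing nu f = pairing mu1 f + pairing mu2 f).
Proof.
pose rho : {measure set R -> \bar R} := measure_add mu1 mu2.
have rhoE B : measurable B -> (fun B => (mu1 B + mu2 B)%E) B = rho B.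
  by move=> mB; symmetry; exact: measure_addE.
have rhoT : (rho setT < +oo)%E.
  by rewrite -rhoE// lte_add_pinfty// -ge0_fin_numE// fin_num_measure.
have [nu nuE] := fin_meas_finite (measure_fin_meas rhoE rhoT).
exists nu; split => [B mB|f bf]; first by rewrite -nuE.
have int1 := bounded_meas_integrable mu1 bf.
have int2 := bounded_meas_integrable mu2 bf.
rewrite -(eq_pairing f nuE) (eq_pairing f rhoE) /pairing (integral_measure_add _ int1 int2)//.
by rewrite fineD//; [exact: (integrable_fin_num measurableT int1) |
  exact: (integrable_fin_num measurableT int2)].
Qed.

(** The selector [b] is arbitrary because two are needed: [T_ i <= N * t] at time [t], and
    [T_ i < N * t] for the left limit. *)
Lemma ex_atoms mu (c : R) (b : nat -> bool) (z : nat -> R) K : 0 <= c -> exists nu,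
  (forall B, measurable B ->
     nu B = (mu B + \sum_(i < K) (if b i then (c * \1_B (z i))%:E else 0))%E) /\
  (forall f, bounded_meas f ->
     pairing nu f = pairing mu f + \sum_(i < K) (if b i then c * f (z i) else 0)).
Proof.
move=> c0; elim: K => [|K [nu [nuE nuf]]].
  by exists mu; split => [B mB|f bf]; rewrite big_ord0 ?adde0 ?addr0.
case bK: (b K); last first.
  by exists nu; split => [B mB|f bf]; rewrite big_ord_recr/= bK ?adde0 ?addr0; [exact: nuE | exact: nuf].
have [del [delE delf]] := ex_mscale (dirac (z K) : {finite_measure set R -> \bar R}) c0.
have [rho [rhoE rhof]] := ex_add nu del.
exists rho; split => [B mB|f bf].
  by rewrite big_ord_recr/= bK rhoE// nuE// delE// addeA /dirac EFinM.
rewrite big_ord_recr/= bK rhof// nuf// delf// addrA; congr (_ + c * _).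
rewrite /pairing integral_dirac//; last by apply/measurable_EFinP; case: bf.
by rewrite diracT mul1e.
Qed.

End FiniteMeasureOperations.

Section Path.
Variables (R : realType) (T : Type) (mu0 : T -> fmeas R) (E sig : nat -> T -> R) (w : T).
Variable (N : R).
Hypotheses (N0 : 0 < N) (fin0 : fin_meas (mu0 w)).
Hypothesis (E0 : forall i, 0 <= E i w).
Hypothesis (Einf : forall j, exists2 i, (j <= i)%N & 1 < E i w).

Local Notation T_ i := (arrival E i w).
Local Notation z i := ((arrival E i w + sig i w) / N).

Lemma scaled_preimage (B : set R) : [set N * x | x in B] = (fun y => y / N) @^-1` B.
Proof.
apply/seteqP; split => [_ [x Bx <-]|y By] /=.
  by rewrite mulrAC mulfV ?mul1r// gt_eqF.
by exists (y / N) => //; rewrite mulrC mulfVK// gt_eqF.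
Qed.

Lemma nscale_fin_meas : exists mu1 : {finite_measure set R -> \bar R},
  forall B, measurable B -> nscale N (mu0 w) B = mu1 B.
Proof.
have [mu muE] := fin_meas_finite fin0.
have mdiv : measurable_fun setT (fun y : R => y / N) by exact: measurable_funM.
have [nu [nuE _]] := ex_pushforward mu mdiv.
have Ninv : 0 <= N^-1 by rewrite invr_ge0 ltW.
have [rho [rhoE _]] := ex_mscale nu Ninv.
exists rho => B mB; rewrite rhoE// nuE// /nscale scaled_preimage muE//.
by rewrite -[X in measurable X]setTI; exact: mdiv.
Qed.

Lemma arrival_mono i j : (i <= j)%N -> T_ i <= T_ j.
Proof.
move=> ij; rewrite /arrival -!(big_mkord xpredT (fun l => E l w)).
rewrite (@big_cat_nat _ _ _ i.+1 0 j.+1)//= lerDl; exact: sumr_ge0.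
Qed.

(** Every interarrival time above 1 raises the arrival times by more than 1, and there are
    infinitely many of them. Hence only finitely many atoms are present at any time. *)
Lemma arrival_unbounded (x : R) : exists K, forall i, (K <= i)%N -> x < T_ i.
Proof.
suff [K HK] : exists K, x < T_ K.
  by exists K => i Ki; exact: lt_le_trans HK (arrival_mono Ki).
have H n : exists K, n%:R < T_ K.
  elim: n => [|n [K HK]].
    have [i _ Ei] := Einf 0; exists i; rewrite /arrival big_ord_recr/=.
    by rewrite ltr_wpDl ?sumr_ge0// (lt_trans ltr01).
  have [i Ki Ei] := Einf K.+1; exists i.
  rewrite /arrival big_ord_recr/= -natr1 ltrD//.
  case: i Ki Ei => // i Ki _.
  by apply: lt_le_trans HK _; exact: (arrival_mono (i := K) (j := i)).
have [K HK] := H (Num.truncn x).+1.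
by exists K; apply: lt_trans HK; exact: truncnS_gt.
Qed.

Lemma nprofile_atoms (mu1 : {finite_measure set R -> \bar R}) (t : R) (K : nat) :
  (forall B, measurable B -> nscale N (mu0 w) B = mu1 B) ->
  (forall i, (K <= i)%N -> N * t < T_ i) ->
  fin_meas (nprofile N mu0 E sig w t) /\ forall f, bounded_meas f ->
    pairing (nprofile N mu0 E sig w t) f = pairing mu1 (fun x => f (x - t)) +
      \sum_(i < K) (if T_ i <= N * t then N^-1 * f (z i - t) else 0).
Proof.
move=> mu1E KT.
have msh : measurable_fun setT (fun x : R => x - t) by exact: measurable_funB.
have [nu [nuE nuf]] := ex_pushforward mu1 msh.
have Ninv : 0 <= N^-1 by rewrite invr_ge0 ltW.
have [rho [rhoE rhof]] := ex_atoms nu (fun i => T_ i <= N * t) (fun i => z i - t) K Ninv.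
have xE B : measurable B -> nprofile N mu0 E sig w t B = rho B.
  move=> mB; rewrite rhoE// nuE// -mu1E; last first.
    by rewrite -[X in measurable X]setTI; exact: msh.
  rewrite /nprofile /nscale /profile.
  (* From index [K] on the customers have not arrived by [N * t], so the series reduces to its first
     [K] terms. *)
  rewrite [X in (_ * (_ + X))%E](_ : _ = (\sum_(i < K)
      (if (arrival E i w <= N * t)%R then (\1_B (z i - t)%R)%:E else 0))%E); last first.
    rewrite (nneseries_split 0 K) ?add0n => [|i _]; last by case: ifP; rewrite ?lee_fin.
    rewrite eseries0 ?adde0 => [|i Ki _]; last by rewrite leNgt KT.
    rewrite big_mkord; apply: eq_bigr => i _; case: ifP => // _.
    congr (_%:E); rewrite !indicE scaled_preimage; congr (_%:R); congr nat_of_bool.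
    have -> : z i - t = (arrival E i w + sig i w - N * t) / N.
      by rewrite mulrBl (mulrC N) mulfK ?gt_eqF.
    by apply/idP/idP; rewrite !inE.
  have -> : [set x | [set N * x | x in B] (x - N * t)] =
      [set N * x | x in (fun x => x - t) @^-1` B].
    rewrite !scaled_preimage; apply/seteqP; split => x /=;
      by rewrite mulrBl (mulrC N) mulfK ?gt_eqF.
  rewrite muleDr//; last first.
    apply: ge0_adde_def; rewrite !inE; last by apply: sume_ge0 => i _; case: ifP; rewrite ?lee_fin.
    by case: fin0 => _ [+ _]; apply; rewrite scaled_preimage -[X in measurable X]setTI;
      apply: measurable_funM => //; rewrite -[X in measurable X]setTI; exact: msh.
  congr (_ + _)%E; rewrite ge0_sume_distrr => [|i _]; last by case: ifP; rewrite ?lee_fin.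
  by apply: eq_bigr => i _; case: ifP; rewrite ?mule0.
split; first by apply: (finite_fin_meas (mu := rho)).
by move=> f bf; rewrite (eq_pairing f xE) rhof// nuf.
Qed.

(** One statement for both one-sided limits: near [t] along [F] the set of arrived customers is
    frozen, described by [b], and what remains is a continuous motion of finitely many atoms and of
    the initial measure. *)
Lemma nprofile_cvg (F : set_system R) {FF : ProperFilter F} (t : R) (b : nat -> bool) (K : nat)
    (mu1 : {finite_measure set R -> \bar R}) (f : R -> R) :
  (forall B, measurable B -> nscale N (mu0 w) B = mu1 B) -> Cb f ->
  s @[s --> F] --> t ->
  (\forall s \near F, forall i, (K <= i)%N -> N * s < T_ i) ->
  (forall i, \forall s \near F, (T_ i <= N * s) = b i) ->
  pairing (nprofile N mu0 E sig w s) f @[s --> F] -->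
    pairing mu1 (fun x => f (x - t)) + \sum_(i < K) (if b i then N^-1 * f (z i - t) else 0).
Proof.
move=> mu1E Cbf Ft KT bF.
have bf := Cb_bounded_meas Cbf.
have bFK : \forall s \near F, forall i : 'I_K, (T_ i <= N * s) = b i.
  by apply: filter_forall => i; exact: bF.
pose G s := pairing mu1 (fun x => f (x - s)) +
  \sum_(i < K) (if b i then N^-1 * f (z i - s) else 0).
have GE : {near F, G =1 (fun s => pairing (nprofile N mu0 E sig w s) f)}.
  near=> s.
  have [|_ ->//] := @nprofile_atoms mu1 s K mu1E; first by near: s.
  have bs : forall i : 'I_K, (T_ i <= N * s) = b i by near: s.
  by rewrite /G; congr (_ + _); apply: eq_bigr => i _; rewrite bs.
apply: cvg_trans (near_eq_cvg GE) _.
apply: cvgD.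
  have H := @cvg_comp _ _ _ id (fun s => pairing mu1 (fun x => f (x - s))) F _ _ Ft (pairing_shift_continuous (nu := mu1) Cbf (x := t)).
 exact H.
apply: (@cvg_rsum R F FF K (fun i s => if b i then N^-1 * f (z i - s) else 0) (fun i => if b i then N^-1 * f (z i - t) else 0)) => i.
case: (b i); last exact: cvg_cst.
apply: cvgM; first exact: cvg_cst.
have ct : {for t, continuous (fun s => f (z i - s))}.
  apply: (@continuous_comp _ _ _ (fun u : R => z i - u) f); last by case: Cbf => cf _; exact: cf.
  by apply: cvgB; [exact: cvg_cst | exact: cvg_id].
exact: (@cvg_comp _ _ _ id (fun s => f (z i - s)) F _ _ Ft ct).
Unshelve. all: end_near. Qed.

Lemma nprofile_cadlag : cadlag (nprofile N mu0 E sig w).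
Proof.
have [mu1 mu1E] := nscale_fin_meas.
have finx t : fin_meas (nprofile N mu0 E sig w t).
  have [K KT] := arrival_unbounded (N * t).
  by have [] := nprofile_atoms mu1E KT.
split; first by move=> t _; exact: finx.
split=> [t _ f Cbf|t _].
  (* The margin 1 gives a single [K] valid on a right neighbourhood of [t]. *)
  have [K KT] := arrival_unbounded (N * (t + 1)).
  have KT' i : (K <= i)%N -> N * t < T_ i.
    by move=> /KT; apply: le_lt_trans; rewrite ler_pM2l// lerDl.
  have [_ ->] := nprofile_atoms mu1E KT'; last exact: Cb_bounded_meas.
  apply: (nprofile_cvg (b := fun i => T_ i <= N * t)) => //.
  - exact: cvg_at_right_filter.
  - near=> s; have st : s <= t + 1 by near: s; apply: nbhs_right_le; rewrite ltrDl.
    by move=> i /KT; apply: le_lt_trans; rewrite ler_pM2l.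
  - move=> i; have [Tt|tT] := leP (T_ i) (N * t).
      near=> s; have ts : t <= s by near: s; exact: nbhs_right_ge.
      by rewrite (le_trans Tt)// ler_pM2l.
    have tTi : t < T_ i / N by rewrite ltr_pdivlMr// mulrC.
    near=> s; have sT : s < T_ i / N by near: s; exact: nbhs_right_lt.
    by apply/negbTE; rewrite -ltNge mulrC -ltr_pdivlMr.
have [K KT] := arrival_unbounded (N * t).
have msh : measurable_fun setT (fun x : R => x - t) by exact: measurable_funB.
have [nu [nuE nuf]] := ex_pushforward mu1 msh.
have Ninv : 0 <= N^-1 by rewrite invr_ge0 ltW.
(* The strict inequality leaves out customers arriving exactly at [N * t]: they are absent just
   before [t]. *)
have [rho [rhoE rhof]] := ex_atoms nu (fun i => T_ i < N * t) (fun i => z i - t) K Ninv.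
exists rho; split; first exact: (finite_fin_meas (mu := rho)).
move=> f Cbf; have bf := Cb_bounded_meas Cbf.
rewrite rhof// nuf//.
apply: (nprofile_cvg (b := fun i => T_ i < N * t)) => //.
- exact: cvg_at_left_filter.
- near=> s; have st : s <= t by near: s; exact: nbhs_left_le.
  by move=> i /KT; apply: le_lt_trans; rewrite ler_pM2l.
- move=> i; have [tT|Tt] := leP (N * t) (T_ i).
    near=> s; have st : s < t by near: s; exact: nbhs_left_lt.
    by apply/negbTE; rewrite -ltNge (lt_le_trans _ tT)// ltr_pM2l.
  have tTi : T_ i / N < t by rewrite ltr_pdivrMr// mulrC.
  near=> s; have sT : T_ i / N <= s by near: s; exact: nbhs_left_ge.
  by rewrite mulrC -ler_pdivrMr.
Unshelve. all: end_near. Qed.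

Lemma nprofile_tail (t a : R) (K : nat) : (forall i, (K <= i)%N -> N * t < T_ i) ->
  tail (nprofile N mu0 E sig w t) (a - t) = tail (nscale N (mu0 w)) a +
    departures_after N (fun i => E i w) (fun i => sig i w) K t a.
Proof.
move=> KT; have [mu1 mu1E] := nscale_fin_meas.
have [finx xf] := nprofile_atoms mu1E KT.
have [nu nuE] := fin_meas_finite finx.
have bI (c : R) : bounded_meas (\1_`[c, +oo[ : R -> R).
  by split => //; exists 1 => x; rewrite indic_ray; case: (c <= x); rewrite ?normr0 ?normr1.
rewrite (eq_tail _ nuE) (eq_tail _ mu1E) /tail -!pairing_indic// -(eq_pairing _ nuE) xf//.
congr (_ + _).
  by congr (pairing _ _); apply/funext => x; rewrite !indic_ray lerD2r.
rewrite /departures_after mulr_sumr; apply: eq_bigr => i _.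
rewrite indic_ray lerD2r ler_pdivlMr// (mulrC a).
by rewrite -/(arrival E i w); case: ifP => //= _; rewrite mulr0.
Qed.

Hypothesis sig0 : forall i, 0 <= sig i w.

(** With nonnegative arrival and service times every departure is at 0 or later, so counting all
    arrivals is the threshold 0 of [departures_after]; the mass follows from the same estimate as
    the tails. *)
Lemma nprofile_mass (t : R) (K : nat) : (forall i, (K <= i)%N -> N * t < T_ i) ->
  mass (nprofile N mu0 E sig w t) = mass (nscale N (mu0 w)) +
    departures_after N (fun i => E i w) (fun i => sig i w) K t 0.
Proof.
move=> KT; have [mu1 mu1E] := nscale_fin_meas.
have [finx xf] := nprofile_atoms mu1E KT.
have [nu nuE] := fin_meas_finite finx.
have bI : bounded_meas (\1_setT : R -> R).
  by split => //; exists 1 => x; rewrite indicT normr1.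
rewrite (eq_mass nuE) (eq_mass mu1E) /mass -!pairing_indic// -(eq_pairing _ nuE) xf//.
have -> : (fun x : R => \1_[set: R] (x - t)) = \1_[set: R] :> (R -> R).
  by apply/funext => x; rewrite !indicT.
congr (_ + _).
rewrite /departures_after mulr_sumr; apply: eq_bigr => i _.
rewrite indicT mulr0 -/(arrival E i w).
have T0 : 0 <= T_ i by exact: sumr_ge0.
by rewrite (addr_ge0 T0 (sig0 i)) andbT; case: ifP; rewrite ?mulr0.
Qed.

End Path.

(** * Weak laws of large numbers *)

Section ConvergenceInProbability.
Context {R : realType} {d : measure_display} {T : measurableType d}.
Variable P : probability T R.

Definition cvg_pr (Z : nat -> T -> R) (z : R) : Prop :=
  forall e del : R, 0 < e -> 0 < del ->
    \forall k \near \oo, (P [set w | (e < `|Z k w - z|)%R] <= del%:E)%E.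

Lemma indicZ_integrable (B : set T) (c : R) : measurable B ->
  P.-integrable setT (EFin \o (fun w => c * (\1_B w : R))).
Proof.
move=> mB; apply: (@bounded_integrable _ _ _ P _ _ `|c|) => //.
  exact: measurable_funM.
move=> w _; rewrite normrM ler_piMr// indicE.
by case: (w \in B); rewrite /= ?normr0 ?normr1.
Qed.

Lemma integrable_rsum (I : Type) (s : seq I) (f : I -> T -> R) :
  (forall i, P.-integrable setT (EFin \o f i)) ->
  P.-integrable setT (EFin \o (fun w => \sum_(i <- s) f i w)).
Proof.
move=> intf; apply: (eq_integrable _ (fun w => \sum_(i <- s) (EFin \o f i) w)%E) => //.
  by move=> w _; rewrite /= sumEFin.
exact: integrable_sum.
Qed.

Lemma markov_ineq (f : T -> R) (r : R) : 0 < r -> (forall w, 0 <= f w) ->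
  P.-integrable setT (EFin \o f) ->
  (P [set w | (r < f w)%R] <= (r^-1 * \int[P]_w f w)%:E)%E.
Proof.
move=> r0 f0 intf.
have mf : measurable_fun setT f by apply/measurable_EFinP; case/integrableP: intf.
have mB : measurable [set w | r < f w].
  by rewrite -[X in measurable X]setTI; exact: measurable_fun_ltr.
rewrite -(@fineK _ (P _)) ?fin_num_measure// lee_fin -ler_pdivrMl ?invr_gt0// invrK.
rewrite -Rintegral_indic//.
have intB : P.-integrable setT (EFin \o (\1_[set w | r < f w] : T -> R)).
  exact: indic_integrable.
rewrite -RintegralZl//; apply: le_Rintegral => //.
  exact: indicZ_integrable.
move=> w _; rewrite indicE; have [wB|_] := boolP (w \in _); rewrite ?mulr1 ?mulr0//.
by move/set_mem: wB => /ltW.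
Qed.

(** Pairwise independence makes the cross moments of the centred indicators vanish, and each square
    is at most 1, so the sum has second moment at most [n]. *)
Lemma chebyshev_indic (A : nat -> set T) (p r : R) (n : nat) :
  (forall i, measurable (A i)) -> (forall i, P (A i) = p%:E) ->
  (forall i j, i != j -> P (A i `&` A j) = (p * p)%:E) -> 0 < r ->
  (P [set w | (r < `|\sum_(i < n) \1_(A i) w - n%:R * p|)%R] <= (n%:R / r ^+ 2)%:E)%E.
Proof.
move=> mA PA PAA r0.
pose Y i (w : T) : R := \1_(A i) w - p.
have YE w : \sum_(i < n) \1_(A i) w - n%:R * p = \sum_(i < n) Y i w.
  by rewrite sumrB sumr_const card_ord mulr_natl.
have p01 : 0 <= p <= 1.
  by rewrite -!lee_fin -(PA 0%N) measure_ge0 probability_le1.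
have mY i : measurable_fun setT (Y i) by exact: measurable_funB.
have Yb i w : `|Y i w| <= 1.
  move: p01; rewrite /Y indicE ler_norml => /andP[? ?].
  by case: (_ \in _) => /=; apply/andP; split; lra.
have intYY i j : P.-integrable setT (EFin \o (fun w => Y i w * Y j w)).
  apply: (@bounded_integrable _ _ _ P _ _ 1) => //; first exact: measurable_funM.
  by move=> w _; rewrite normrM mulr_ile1.
have EY i j : \int[P]_w (Y i w * Y j w) <= (i == j)%:R.
  case: eqP => [<-|/eqP ij]/=.
    rewrite (le_trans (_ : _ <= \int[P]_w cst 1 w))//.
      apply: le_Rintegral => //; first exact: finite_measure_integrable_cst.
      by move=> w _; rewrite (le_trans (ler_norm _))// normrM mulr_ile1.
    by rewrite Rintegral_cst//= probability_setT mulr1.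
  have ind (B : set T) : measurable B -> P.-integrable setT (EFin \o (\1_B : T -> R)).
    exact: indic_integrable.
  have -> : \int[P]_w (Y i w * Y j w) =
      \int[P]_w ((\1_(A i `&` A j) w - p * \1_(A i) w) - (p * \1_(A j) w - p * p)).
    apply: eq_Rintegral => w _; rewrite /Y indicI /=; ring.
  have intp B : measurable B -> P.-integrable setT (EFin \o (fun w => p * (\1_B : T -> R) w)).
    exact: indicZ_integrable.
  have mI : measurable (A i `&` A j) by exact: measurableI.
  have intc : P.-integrable setT (EFin \o (fun=> p * p)).
    exact: (@bounded_integrable _ _ _ P _ _ `|p * p|).
  have i1 := integrableB measurableT (ind _ mI) (intp _ (mA i)).
  have i2 := integrableB measurableT (intp _ (mA j)) intc.
  rewrite (RintegralB measurableT i1 i2) (RintegralB measurableT (ind _ mI) (intp _ (mA i))).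
  rewrite (RintegralB measurableT (intp _ (mA j)) intc).
  rewrite (RintegralZl _ measurableT (ind _ (mA i))) (RintegralZl _ measurableT (ind _ (mA j))).
  have -> : \int[P]_w (fun=> p * p) w = p * p.
    by rewrite Rintegral_cst//= probability_setT mulr1.
  have eI (B : set T) (mB : measurable B) : \int[P]_w \1_B w = fine (P B) := Rintegral_indic P mB.
  by rewrite !eI// PAA// !PA /=; lra.
pose Q w := (\sum_(i < n) Y i w) ^+ 2.
have QE w : Q w = \sum_(i < n) \sum_(j < n) Y i w * Y j w.
  by rewrite /Q expr2 mulr_suml; apply: eq_bigr => i _; rewrite mulr_sumr.
have intS i : P.-integrable setT (EFin \o (fun w => \sum_(j < n) Y i w * Y j w)).
  exact: integrable_rsum.
have intQ : P.-integrable setT (EFin \o Q).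
  by rewrite (_ : Q = fun w => \sum_(i < n) \sum_(j < n) Y i w * Y j w);
    [exact: integrable_rsum | apply/funext].
have EQ : \int[P]_w Q w <= n%:R.
  under eq_Rintegral do rewrite QE.
  rewrite Rintegral_sum//.
  rewrite (le_trans (_ : _ <= \sum_(i < n) 1))//; last by rewrite sumr_const card_ord.
  apply: ler_sum => i _; rewrite Rintegral_sum//.
  rewrite (le_trans (_ : _ <= \sum_(j < n) (i == j)%:R))//.
    by apply: ler_sum => j _; exact: EY.
  by rewrite (bigD1 i)//= eqxx big1 ?addr0// => j /negbTE; rewrite eq_sym => ->.
have r2 : 0 < r ^+ 2 by rewrite exprn_gt0.
have -> : [set w | r < `|\sum_(i < n) \1_(A i) w - n%:R * p|] = [set w | r ^+ 2 < Q w].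
  apply/seteqP; split => w /=; rewrite YE /Q -(real_normK (num_real (\sum_(i < n) Y i w)));
    by rewrite ltr_pXn2r// nnegrE ltW.
apply: le_trans (markov_ineq r2 _ intQ) _ => [w|]; first exact: sqr_ge0.
by rewrite lee_fin mulrC ler_wpM2r// invr_ge0 ltW.
Qed.

Lemma lln_indic (A : nat -> nat -> set T) (p : nat -> R) (q c : R) (n : nat -> nat) :
  (forall k i, measurable (A k i)) -> (forall k i, P (A k i) = (p k)%:E) ->
  (forall k i j, i != j -> P (A k i `&` A k j) = (p k * p k)%:E) ->
  p k @[k --> \oo] --> q -> ((n k)%:R / k.+1%:R : R) @[k --> \oo] --> c ->
  cvg_pr (fun k w => k.+1%:R^-1 * \sum_(i < n k) \1_(A k i) w) (c * q).
Proof.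
move=> mA PA PAA pq nc e del e0 del0.
have cpq : ((n k)%:R / k.+1%:R * p k : R) @[k --> \oo] --> c * q by exact: cvgM.
have e2 : 0 < e / 2 by rewrite divr_gt0.
near=> k.
have k0 : 0 < (k.+1%:R : R) by rewrite ltr0n.
have h1 : `|c * q - (n k)%:R / k.+1%:R * p k| <= e / 2.
  by near: k; apply: cvgr_dist_le.
have h2 : (n k)%:R / k.+1%:R <= c + 1.
  suff : `|c - (n k)%:R / k.+1%:R| <= 1.
    by move: (_ / _) => x; rewrite ler_norml => /andP[? ?]; lra.
  by near: k; apply: cvgr_dist_le.
(* Chebyshev's bound [n k / r ^+ 2] with [r = k.+1 * (e / 2)] is at most
   [(c + 1) / (k.+1 * (e / 2) ^+ 2)], which is at most [del] for such [k]. *)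
have h3 : (c + 1) / (del * (e / 2) ^+ 2) <= k.+1%:R.
  rewrite (@le_trans _ _ k%:R) ?ler_nat//.
  by near: k; exact: nbhs_infty_ger.
have r0 : 0 < k.+1%:R * (e / 2) by rewrite mulr_gt0.
have mS c' : measurable_fun setT (fun w => `|\sum_(i < n k) \1_(A k i) w - c'| : R).
  apply: measurableT_comp => //; apply: measurable_funB => //.
  by apply: measurable_sum => i; exact: measurable_indic.
apply: (@le_trans _ _ (P [set w | (k.+1%:R * (e / 2) < `|\sum_(i < n k) \1_(A k i) w - (n k)%:R * p k|)%R])).
  apply: le_measure; rewrite ?inE.
  - rewrite -[X in measurable X]setTI; apply: measurable_fun_ltr => //.
    apply: measurableT_comp => //; apply: measurable_funB => //.
    by apply: measurable_funM => //; apply: measurable_sum => i; exact: measurable_indic.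
  - by rewrite -[X in measurable X]setTI; exact: measurable_fun_ltr.
  move=> w /= he.
  rewrite -ltr_pdivlMl//.
  have -> : k.+1%:R^-1 * `|\sum_(i < n k) \1_(A k i) w - (n k)%:R * p k| =
     `|k.+1%:R^-1 * \sum_(i < n k) \1_(A k i) w - (n k)%:R / k.+1%:R * p k|.
    rewrite -[X in X * _ = _](ger0_norm (_ : 0 <= k.+1%:R^-1)) ?invr_ge0// -normrM.
    by congr (`|_|); rewrite mulrBr; congr (_ - _); ring.
  rewrite -(ltrD2r (e / 2)) -splitr (lt_le_trans he)//.
  set u := _^-1 * _; set v := _ / _ * _.
  have -> : u - c * q = (u - v) - (c * q - v) by ring.
  by rewrite (le_trans (ler_normB _ _))// lerD2l.
apply: le_trans (chebyshev_indic (n k) (mA k) (PA k) (PAA k) r0) _.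
rewrite lee_fin exprMn ler_pdivrMr ?mulr_gt0 ?exprn_gt0//.
rewrite ler_pdivrMr// in h2.
apply: le_trans h2 _.
rewrite ler_pdivrMr ?mulr_gt0 ?exprn_gt0// in h3.
rewrite (le_trans (ler_wpM2r (ltW k0) h3))//.
by rewrite le_eqVlt; apply/orP; left; apply/eqP; ring.
Unshelve. all: end_near. Qed.

Lemma measurable_dist (Z : T -> R) (z e : R) : measurable_fun setT Z ->
  measurable [set w | e < `|Z w - z|].
Proof.
move=> mZ; rewrite -[X in measurable X]setTI; apply: measurable_fun_ltr => //.
by apply: measurableT_comp => //; exact: measurable_funB.
Qed.

Lemma cvg_prD (Z1 Z2 : nat -> T -> R) (z1 z2 : R) :
  (forall k, measurable_fun setT (Z1 k)) -> (forall k, measurable_fun setT (Z2 k)) ->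
  cvg_pr Z1 z1 -> cvg_pr Z2 z2 -> cvg_pr (fun k w => Z1 k w + Z2 k w) (z1 + z2).
Proof.
move=> m1 m2 c1 c2 e del e0 del0.
have e2 : 0 < e / 2 by rewrite divr_gt0.
have del2 : 0 < del / 2 by rewrite divr_gt0.
have := c1 _ _ e2 del2; have := c2 _ _ e2 del2.
apply: filterS2 => k h2 h1.
apply: (@le_trans _ _ (P ([set w | e / 2 < `|Z1 k w - z1|] `|` [set w | e / 2 < `|Z2 k w - z2|]))).
  apply: le_measure; rewrite ?inE; [| apply: measurableU|]; try by apply: measurable_dist => //; exact: measurable_funD.
  move=> w /= he; apply: contrapT => /not_orP[/negP + /negP].
  rewrite -!leNgt => a1 a2; move: he; apply/negP; rewrite -leNgt.
  have -> : Z1 k w + Z2 k w - (z1 + z2) = (Z1 k w - z1) + (Z2 k w - z2) by ring.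
  by rewrite (le_trans (ler_normD _ _))// [leRHS]splitr lerD.
have U := @measureU2 _ _ _ P _ _ (measurable_dist z1 (e / 2) (m1 k)) (measurable_dist z2 (e / 2) (m2 k)).
apply: (le_trans U).
by rewrite [del]splitr EFinD leeD.
Qed.

Lemma cvg_prZ (Z : nat -> T -> R) (z c : R) : cvg_pr Z z -> cvg_pr (fun k w => c * Z k w) (c * z).
Proof.
move=> cZ e del e0 del0; have [->|c0] := eqVneq c 0.
  near=> k; rewrite (_ : [set w | _] = set0) ?measure0 ?lee_fin ?ltW//.
  by apply/seteqP; split => w //=; rewrite !mul0r subrr normr0 ltNge ltW.
have c1 : 0 < `|c| by rewrite normr_gt0.
have := cZ (e / `|c|) del (divr_gt0 e0 c1) del0; apply: filterS => k.
rewrite (_ : [set w | e / `|c| < _] = [set w | e < `|c * Z k w - c * z|])//.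
by apply/seteqP; split => w /=; rewrite -mulrBr normrM ltr_pdivrMr// (mulrC `|c|).
Unshelve. all: end_near. Qed.

Lemma cvg_pr_sum (Z : nat -> nat -> T -> R) (z : nat -> R) M :
  (forall m k, measurable_fun setT (Z m k)) -> (forall m, cvg_pr (Z m) (z m)) ->
  cvg_pr (fun k w => \sum_(m < M) Z m k w) (\sum_(m < M) z m).
Proof.
move=> mZ cZ; elim: M => [|M IH].
  move=> e del e0 del0; near=> k.
  rewrite (_ : [set w | _] = set0) ?measure0 ?lee_fin ?ltW//.
  by apply/seteqP; split => w //=; rewrite !big_ord0 subrr normr0 ltNge ltW.
rewrite big_ord_recr /= (_ : (fun k w => _) = (fun k w => \sum_(m < M) Z m k w + Z M k w)).
  by apply: cvg_prD => // k; apply: measurable_sum.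
by apply/funext => k; apply/funext => w; rewrite big_ord_recr.
Unshelve. all: end_near. Qed.

Lemma mutual_indep_pair (I : eqType) (X : I -> T -> R) (i j : I) (B1 B2 : set R) :
  mutual_indep P X -> i != j -> measurable B1 -> measurable B2 ->
  P (X i @^-1` B1 `&` X j @^-1` B2) = (P (X i @^-1` B1) * P (X j @^-1` B2))%E.
Proof.
move=> indX ij mB1 mB2.
pose B l := if l == i then B1 else B2.
have uij : uniq [:: i; j] by rewrite /= inE ij.
have mB l : measurable (B l) by rewrite /B; case: ifP.
have := indX [:: i; j] B uij mB.
by rewrite !big_cons !big_nil setIT mule1 /B eqxx eq_sym (negbTE ij).
Qed.

Lemma exp_law_gt (lam : R) (E : T -> R) (x : R) : measurable_fun setT E ->
  exp_law P lam E -> 0 <= x -> P [set w | x < E w] = (expR (- (lam * x)))%:E.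
Proof.
move=> mE lE x0.
rewrite (_ : [set w | x < E w] = ~` [set w | E w <= x]); last first.
  by apply/seteqP; split => w /=; [move=> ?; apply/negP; rewrite -ltNge|move/negP; rewrite -ltNge].
rewrite probability_setC ?lE ?x0 -?EFinB; last first.
  by rewrite -[X in measurable X]setTI; exact: measurable_fun_ler.
by congr (_%:E); ring.
Qed.

(** By the layer-cake formula the mean is the integral of the complementary distribution function,
    which on the half-line coincides with the exponential density of rate 1, of integral 1. *)
Lemma expectation_exp1 (U : T -> R) : measurable_fun setT U ->
  (forall x, 0 <= x -> P [set w | x < U w] = (expR (- x))%:E) ->
  (\int[P]_w (Num.max 0 (U w))%:E = 1)%E.
Proof.
move=> mU PU.
pose X := fun w => Num.max 0 (U w).
have mX : measurable_fun setT X by apply: measurable_maxr.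
pose XX : {RV P >-> R} := mfun_Sub (mem_set mX).
have := @ge0_expectation_ccdf _ _ _ P XX.
rewrite unlock => -> => [|w]; last by rewrite /= /X le_max lexx.
rewrite -(@integral_exponential_pdf R 1 ltr01) [LHS]integral_mkcond.
apply: eq_integral => x _; rewrite /exponential_pdf !patchE.
case: ifP => //; rewrite inE/= in_itv/= andbT => x0.
rewrite mul1r mulN1r -PU// /ccdf /distribution /= /pushforward; congr (P _).
apply/seteqP; split => w /=; rewrite in_itv/= andbT /X lt_max.
  by case/orP => // x00; move: (lt_le_trans x00 x0); rewrite ltxx.
by move=> ->; rewrite orbT.
Qed.

(** The sum counts multiples of [del] below [x]. The induction carries the extra bound [M%:R * del]:
    when the next multiple is below [x], that bound plus [del] still is. *)
Lemma sum_indic_le (x del : R) M : 0 < del -> 0 <= x ->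
  del * \sum_(m < M) (m.+1%:R * del < x)%R%:R <= x.
Proof.
move=> del0 x0.
suff [] : del * \sum_(m < M) (m.+1%:R * del < x)%R%:R <= x /\
  del * \sum_(m < M) (m.+1%:R * del < x)%R%:R <= M%:R * del by [].
elim: M => [|M [IH1 IH2]]; first by rewrite big_ord0 mulr0 mul0r.
rewrite big_ord_recr/= mulrDr -natr1 mulrDl mul1r; case: ltP => /= h.
  by rewrite mulr1; split; lra.
by rewrite mulr0 addr0; split => //; lra.
Qed.

(** A truncated lower Riemann sum of [exp (- x)], whose integral over the half-line is 1; it is
    geometric with ratio [q = expR (- del)]. *)
Lemma exp_riemann (eps : R) : 0 < eps -> exists del : R, exists M : nat,
  0 < del /\ 0 <= 1 - del * \sum_(m < M) expR (- (m.+1%:R * del)) <= eps.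
Proof.
move=> eps0.
pose del := Num.min 2^-1 (eps / 2).
have del0 : 0 < del by rewrite lt_min invr_gt0 ltr0n divr_gt0.
have del1 : del <= 2^-1 by rewrite ge_min lexx.
have dele : del <= eps / 2 by rewrite ge_min lexx orbT.
(* Since [expR x >= 1 + x], a total length of at least [2 / eps] brings [q ^+ M.+1] below [eps / 2];
   the other half of [eps] pays for the mesh. *)
pose M := Num.truncn (2 / eps / del).
have MM : 2 / eps <= M.+1%:R * del by rewrite -ler_pdivrMr// ltW// truncnS_gt.
exists del, M.+1; split => //.
pose q := expR (- del).
have q0 : 0 < q by exact: expR_gt0.
have q1 : q < 1 by rewrite expR_lt1 oppr_lt0.
have qd : 1 - q <= del by have := expR_ge1Dx (- del); rewrite /q; lra.
have qE m : expR (- (m%:R * del)) = q ^+ m.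
  by rewrite -mulrN -expRM_natl.
have geo m : (1 - q) * \sum_(i < m) expR (- (i.+1%:R * del)) = q * (1 - q ^+ m).
  elim: m => [|m IH]; first by rewrite big_ord0 expr0; ring.
  rewrite big_ord_recr/= mulrDr IH qE exprS; ring.
have G := geo M.+1; set S := \sum_(m < _) _ in G *.
have qM : q ^+ M.+1 <= eps / 2.
  rewrite -qE expRN invf_ple ?posrE ?expR_gt0 ?divr_gt0// invf_div.
  have := expR_ge1Dx (M.+1%:R * del); lra.
have qM0 : 0 < q ^+ M.+1 by rewrite exprn_gt0.
have S0 : 0 <= S by apply: sumr_ge0 => i _; exact: expR_ge0.
(* (1 - q) S <= del S and 1 - del <= q; conversely del q <= 1 - q. *)
have lb : (1 - del) * (1 - eps / 2) <= del * S.
  apply: (@le_trans _ _ ((1 - q) * S)); last by rewrite ler_wpM2r.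
  rewrite G; apply: (@le_trans _ _ ((1 - del) * (1 - q ^+ M.+1))).
    by rewrite ler_wpM2l ?lerD2l ?lerN2//; lra.
  have : q ^+ M.+1 <= 1 by rewrite exprn_ile1// ltW.
  by move=> ?; rewrite ler_wpM2r//; lra.
have ub : del * S <= 1.
  have dq : del * q <= 1 - q.
    have : q * expR del = 1 by rewrite /q expRN mulVf// gt_eqF// expR_gt0.
    have : q * (1 + del) <= q * expR del by rewrite ler_pM2l// expR_ge1Dx.
    lra.
  have : del * q * S <= (1 - q) * S by rewrite ler_wpM2r.
  rewrite G => h; have : q * (del * S) <= q * 1.
    have qq : 0 <= q * q ^+ M.+1 by rewrite mulr_ge0// ltW.
    have -> : q * (del * S) = del * q * S by ring.
    by move: h; rewrite mulrBr; lra.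
  by rewrite ler_pM2l.
apply/andP; split; first by rewrite subr_ge0.
have : 0 <= del * (eps / 2) by rewrite mulr_ge0 ?divr_ge0 ?ltW.
by move: lb; rewrite mulrBl mulrBr; lra.
Qed.

(** [max 0 U] is split into the slices [del * 1[U > m.+1 * del]], to which the law for indicators
    applies, and a nonnegative remainder of small mean [kap], to which Markov's inequality
    applies. *)
Lemma lln_exp1 (U : nat -> nat -> T -> R) (n : nat -> nat) (c : R) :
  (forall k i, measurable_fun setT (U k i)) ->
  (forall k i x, 0 <= x -> P [set w | x < U k i w] = (expR (- x))%:E) ->
  (forall k i j x, 0 <= x -> i != j ->
     P ([set w | x < U k i w] `&` [set w | x < U k j w]) = (expR (- x) * expR (- x))%:E) ->
  ((n k)%:R / k.+1%:R : R) @[k --> \oo] --> c ->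
  cvg_pr (fun k w => k.+1%:R^-1 * \sum_(i < n k) Num.max 0 (U k i w)) c.
Proof.
move=> mU PU PUU nc e eta e0 eta0.
have c0 : 0 <= c.
  by apply: (cvgr_to_ge nc); near=> k; rewrite divr_ge0.
have c1 : 0 < c + 1 by lra.
(* The first bound keeps the bias [c * kap] below [e / 3]; the second makes Markov's bound for the
   remainder at level [e / 3] at most [eta / 2]. *)
pose eps := Num.min (e / 3 / (c + 1)) (eta * e / 6 / (c + 1)).
have eps0 : 0 < eps.
  by rewrite lt_min !divr_gt0 ?mulr_gt0.
have [del [M [del0 /andP[kap0 kape]]]] := exp_riemann eps0.
set kap := 1 - _ in kap0 kape.
have epsc : kap * (c + 1) <= e / 3.
  by rewrite -ler_pdivlMr// (le_trans kape)// ge_min lexx.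
have epsc2 : kap * (c + 1) <= eta * e / 6.
  by rewrite -ler_pdivlMr// (le_trans kape)// ge_min lexx orbT.
pose A (m : nat) k i := [set w | m.+1%:R * del < U k i w].
have mA m k i : measurable (A m k i).
  by rewrite /A -[X in measurable X]setTI; exact: measurable_fun_ltr.
have md0 m : 0 <= (m.+1%:R * del : R) by rewrite mulr_ge0// ltW.
pose L k w := \sum_(m < M) del * (k.+1%:R^-1 * \sum_(i < n k) (\1_(A m k i) w : R)).
have mLm m k : measurable_fun setT (fun w => del * (k.+1%:R^-1 * \sum_(i < n k) (\1_(A m k i) w : R))).
  apply: measurable_funM => //; apply: measurable_funM => //.
  by apply: measurable_sum => i; exact: measurable_indic.
have mL k : measurable_fun setT (L k) by apply: measurable_sum => m; exact: mLm.
have cL : cvg_pr L (\sum_(m < M) del * (c * expR (- (m.+1%:R * del)))).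
  apply: (@cvg_pr_sum (fun m k w => del * (k.+1%:R^-1 * \sum_(i < n k) (\1_(A m k i) w : R)))
    (fun m => del * (c * expR (- (m.+1%:R * del)))) M mLm) => m.
  apply: cvg_prZ; apply: (lln_indic (p := fun=> expR (- (m.+1%:R * del)))) => //.
  - by move=> k i; rewrite /A PU.
  - by move=> k i j ij; rewrite /A PUU.
  - exact: cvg_cst.
have LE : \sum_(m < M) del * (c * expR (- (m.+1%:R * del))) = c * (1 - kap).
  rewrite /kap subKr mulrA (mulrC c) -mulrA mulr_sumr mulr_sumr.
  by [].
rewrite LE in cL.
pose f (w : T) (u : R) := Num.max 0 u - del * \sum_(m < M) (m.+1%:R * del < u)%R%:R.
pose D k w := k.+1%:R^-1 * \sum_(i < n k) Num.max 0 (U k i w) - L k w.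
pose Di k i w := Num.max 0 (U k i w) - \sum_(m < M) del * (\1_(A m k i) w : R).
have DE k w : D k w = k.+1%:R^-1 * \sum_(i < n k) Di k i w.
  rewrite /D /Di sumrB mulrBr; congr (_ - _); rewrite /L exchange_big/= mulr_sumr.
  by apply: eq_bigr => m _; rewrite mulrCA mulr_sumr.
have Di0 k i w : 0 <= Di k i w.
  rewrite /Di -mulr_sumr subr_ge0; have [u0|u0] := leP 0 (U k i w).
    rewrite [leLHS](_ : _ = del * \sum_(m < M) (m.+1%:R * del < U k i w)%R%:R).
      by rewrite sum_indic_le.
    congr (_ * _); apply: eq_bigr => m _; rewrite indicE; congr (_%:R); congr nat_of_bool.
    by rewrite /A; apply/idP/idP; rewrite inE.
  rewrite big1 ?mulr0// => m _; rewrite indicE memNset//= => h.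
  by have := lt_trans h u0; rewrite ltNge md0.
have mDi k i : measurable_fun setT (Di k i).
  apply: measurable_funB; first exact: measurable_maxr.
  by apply: measurable_sum => m; apply: measurable_funM => //; exact: measurable_indic.
have intmax k i : P.-integrable setT (EFin \o (fun w => Num.max 0 (U k i w))).
  apply/integrableP; split; first by apply/measurable_EFinP; exact: measurable_maxr.
  under eq_integral do rewrite /= ger0_norm ?le_max ?lexx//.
  by rewrite (expectation_exp1 (mU k i) (PU k i)) ltry.
have intsum k i : P.-integrable setT (EFin \o (fun w => \sum_(m < M) del * (\1_(A m k i) w : R))).
  by apply: integrable_rsum => m; exact: indicZ_integrable.
have intDi k i : P.-integrable setT (EFin \o Di k i).
  exact: (integrableB measurableT (intmax k i) (intsum k i)).
have EDi k i : \int[P]_w Di k i w = kap.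
  rewrite (RintegralB measurableT (intmax k i) (intsum k i)).
  rewrite [X in X - _](_ : _ = 1); last first.
    by rewrite /Rintegral (expectation_exp1 (mU k i) (PU k i)).
  rewrite Rintegral_sum => [|m]; last exact: indicZ_integrable.
  rewrite /kap; congr (1 - _); rewrite mulr_sumr; apply: eq_bigr => m _.
  rewrite RintegralZl//; last exact: indic_integrable.
  have -> : \int[P]_w \1_(A m k i) w = fine (P (A m k i)) := Rintegral_indic P (mA m k i).
  by rewrite /A PU.
have intD k : P.-integrable setT (EFin \o D k).
  have intsD : P.-integrable setT (EFin \o (fun w => \sum_(i < n k) Di k i w)).
    exact: integrable_rsum.
  apply: (eq_integrable _ (fun w => (k.+1%:R^-1)%:E * (EFin \o (fun w => \sum_(i < n k) Di k i w)%R) w)%E) => //.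
    by move=> w _; rewrite /= DE EFinM.
  exact: integrableZl.
have mD k : measurable_fun setT (D k) by apply/measurable_EFinP; case/integrableP: (intD k).
have ED k : \int[P]_w D k w = (n k)%:R / k.+1%:R * kap.
  under eq_Rintegral do rewrite DE.
  rewrite RintegralZl//.
    rewrite Rintegral_sum// (eq_bigr (fun=> kap)) => [|i _]; last exact: EDi.
    by rewrite sumr_const card_ord -mulr_natr; ring.
  exact: integrable_rsum.
have e3 : 0 < e / 3 by rewrite divr_gt0.
have eta2 : 0 < eta / 2 by rewrite divr_gt0.
have := cL _ _ e3 eta2.
have nc1 : \forall k \near \oo, (n k)%:R / k.+1%:R <= c + 1.
  near=> k; suff : `|c - (n k)%:R / k.+1%:R| <= 1.
    by move: (_ / _) => x; rewrite ler_norml => /andP[? ?]; lra.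
  by near: k; apply: cvgr_dist_le.
move: nc1; apply: filterS2 => k nk Lk.
have D0 w : 0 <= D k w by rewrite DE mulr_ge0// sumr_ge0.
have PD : (P [set w | (e / 3 < D k w)%R] <= (eta / 2)%:E)%E.
  apply: le_trans (markov_ineq e3 D0 (intD k)) _.
  rewrite lee_fin ED ler_pdivrMl//.
  apply: (@le_trans _ _ (kap * (c + 1))).
    by rewrite mulrC ler_wpM2l.
  by apply: le_trans epsc2 _; rewrite le_eqVlt; apply/orP; left; apply/eqP; field.
have mmax : measurable_fun setT (fun w => k.+1%:R^-1 * \sum_(i < n k) Num.max 0 (U k i w)).
  by apply: measurable_funM => //; apply: measurable_sum => i; exact: measurable_maxr.
have mDk : measurable [set w | e / 3 < D k w].
  by rewrite -[X in measurable X]setTI; exact: measurable_fun_ltr.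
have mLk := measurable_dist (c * (1 - kap)) (e / 3) (mL k).
apply: (@le_trans _ _ (P ([set w | e / 3 < D k w] `|` [set w | e / 3 < `|L k w - c * (1 - kap)|]))).
  apply: le_measure; rewrite ?inE; [exact: measurable_dist | exact: measurableU |].
  move=> w /= he; apply: contrapT => /not_orP[/negP + /negP].
  rewrite -!leNgt => a1 a2; move: he; apply/negP; rewrite -leNgt.
  set s := _ * _.
  have sE : s = D k w + L k w by rewrite /D subrK.
  have ck : c * kap <= e / 3 by rewrite (le_trans _ epsc)// mulrC ler_wpM2l//; lra.
  have ck0 : 0 <= c * kap by rewrite mulr_ge0.
  have := D0 w; move: a2; rewrite sE mulrBr mulr1 !ler_norml => /andP[? ?] ?.
  by apply/andP; split; lra.
have Um := @measureU2 _ _ _ P _ _ mDk mLk.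
by apply: (le_trans Um); rewrite [eta]splitr EFinD leeD.
Unshelve. all: end_near. Qed.

End ConvergenceInProbability.

(** * Passage to the limit *)

Section TailLimits.
Variable R : realType.
Implicit Types (mu nu : {finite_measure set R -> \bar R}).

Lemma fine_mu_bigcap nu (F : nat -> set R) : (forall n, measurable (F n)) ->
  {homo F : m n / (m <= n)%N >-> n `<=` m} ->
  fine (nu (F n)) @[n --> \oo] --> fine (nu (\bigcap_n F n)).
Proof.
move=> mF dF; have mI : measurable (\bigcap_n F n) by exact: bigcapT_measurable.
apply: fine_cvg; rewrite fineK ?fin_num_measure//.
apply: nonincreasing_cvg_mu => //.
  by rewrite -ge0_fin_numE// fin_num_measure.
by move=> m n mn; apply/subsetPset; exact: dF.
Qed.

Lemma fine_mu_bigcup nu (F : nat -> set R) : (forall n, measurable (F n)) ->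
  {homo F : m n / (m <= n)%N >-> m `<=` n} ->
  fine (nu (F n)) @[n --> \oo] --> fine (nu (\bigcup_n F n)).
Proof.
move=> mF dF; have mU : measurable (\bigcup_n F n) by exact: bigcupT_measurable.
apply: fine_cvg; rewrite fineK ?fin_num_measure//.
apply: nondecreasing_cvg_mu => //.
by move=> m n mn; apply/subsetPset; exact: dF.
Qed.

Lemma tail_cvg_left nu (c e : R) : 0 < e -> exists2 del : R, 0 < del &
  tail nu (c - del) <= tail nu c + e.
Proof.
move=> e0.
pose F (n : nat) := `[c - n.+1%:R^-1, +oo[%classic : set R.
have cF : fine (nu (F n)) @[n --> \oo] --> fine (nu (\bigcap_n F n)).
  apply: fine_mu_bigcap => [n|m n mn x]; first exact: measurable_itv.
  rewrite /F /= !in_itv/= !andbT; apply: le_trans.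
  by rewrite lerD2l lerN2 lef_pV2 ?posrE ?ltr0n// ler_nat ltnS.
have FE : \bigcap_n F n = `[c, +oo[%classic.
  apply/seteqP; split => [x Fx|x /= + n _].
    rewrite /= in_itv/= andbT leNgt; apply/negP => xc.
    have := Fx (Num.truncn (c - x)^-1) I; rewrite /F /= in_itv/= andbT.
    apply/negP; rewrite -ltNge ltrBrDr -ltrBrDl invf_plt ?posrE ?subr_gt0//.
    exact: truncnS_gt.
  by rewrite /F /= !in_itv/= !andbT; apply: le_trans; rewrite gerBl invr_ge0.
rewrite FE in cF.
have /filter_ex[n Hn] : \forall n \near \oo, `|tail nu c - fine (nu (F n))| <= e.
  by apply: cvgr_dist_le.
exists n.+1%:R^-1; first by rewrite invr_gt0.
by move: Hn; rewrite -/(tail nu (c - n.+1%:R^-1)) ler_norml => /andP[]; lra.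
Qed.

(** The rays from [c + 1 / n.+1] increase to the open ray []c, +oo[], which misses [c]; the absence
    of an atom there closes the gap. *)
Lemma tail_cvg_right nu (c e : R) : nu [set c] = 0%E -> 0 < e ->
  exists2 del : R, 0 < del & tail nu c <= tail nu (c + del) + e.
Proof.
move=> nuc e0.
pose F (n : nat) := `[c + n.+1%:R^-1, +oo[%classic : set R.
have cF : fine (nu (F n)) @[n --> \oo] --> fine (nu (\bigcup_n F n)).
  apply: fine_mu_bigcup => [n|m n mn x]; first exact: measurable_itv.
  rewrite /F /= !in_itv/= !andbT; apply: le_trans.
  by rewrite lerD2l lef_pV2 ?posrE ?ltr0n// ler_nat ltnS.
have FE : \bigcup_n F n = `]c, +oo[%classic.
  apply/seteqP; split => [x [n _]|x /=].
    by rewrite /F /= !in_itv/= !andbT; apply: lt_le_trans; rewrite ltrDl invr_gt0.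
  rewrite in_itv/= andbT => cx; exists (Num.truncn (x - c)^-1) => //.
  rewrite /F /= in_itv/= andbT -lerBrDl invf_ple ?posrE ?subr_gt0//.
  exact/ltW/truncnS_gt.
have nuE : nu `]c, +oo[%classic = nu `[c, +oo[%classic.
  rewrite -(@setU1itv _ _ _ _ false) ?bnd_simp// measureU//.
    by rewrite [X in (X + _)%E]nuc add0e.
  by apply/seteqP; split => x //= [->]; rewrite in_itv/= ltxx.
rewrite FE nuE in cF.
have /filter_ex[n Hn] : \forall n \near \oo, `|tail nu c - fine (nu (F n))| <= e.
  by apply: cvgr_dist_le.
exists n.+1%:R^-1; first by rewrite invr_gt0.
by move: Hn; rewrite -/(tail nu (c + n.+1%:R^-1)) ler_norml => /andP[_]; lra.
Qed.

Lemma tail_pinfty nu (e : R) : 0 < e -> exists A : R, forall c, A <= c -> tail nu c <= e.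
Proof.
move=> e0; pose F (n : nat) := `[n%:R, +oo[%classic : set R.
have cF : fine (nu (F n)) @[n --> \oo] --> fine (nu (\bigcap_n F n)).
  apply: fine_mu_bigcap => [n|m n mn x]; first exact: measurable_itv.
  by rewrite /F /= !in_itv/= !andbT; apply: le_trans; rewrite ler_nat.
have FE : \bigcap_n F n = set0.
  apply/seteqP; split => x // Fx.
  have := Fx (Num.truncn x).+1 I; rewrite /F /= in_itv/= andbT leNgt.
  by rewrite truncnS_gt.
rewrite FE measure0 in cF.
have /filter_ex[n Hn] : \forall n \near \oo, `|0 - fine (nu (F n))| <= e.
  by apply: cvgr_dist_le.
exists n%:R => c nc; apply: le_trans (tail_anti nu nc) _.
by move: Hn; rewrite sub0r normrN; apply: le_trans; exact: ler_norm.
Qed.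

Lemma tail_ninfty nu (e : R) : 0 < e -> exists A : R, forall c, c <= A -> mass nu - tail nu c <= e.
Proof.
move=> e0; pose F (n : nat) := `[- n%:R, +oo[%classic : set R.
have cF : fine (nu (F n)) @[n --> \oo] --> fine (nu (\bigcup_n F n)).
  apply: fine_mu_bigcup => [n|m n mn x]; first exact: measurable_itv.
  by rewrite /F /= !in_itv/= !andbT; apply: le_trans; rewrite lerN2 ler_nat.
have FE : \bigcup_n F n = setT.
  apply/seteqP; split => x // _; exists (Num.truncn (- x)).+1 => //.
  by rewrite /F /= in_itv/= andbT lerNl ltW// truncnS_gt.
rewrite FE in cF.
have /filter_ex[n Hn] : \forall n \near \oo, `|mass nu - fine (nu (F n))| <= e.
  by apply: cvgr_dist_le.
exists (- n%:R) => c cn; apply: le_trans Hn; apply: le_trans (ler_norm _).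
by rewrite lerD2l lerN2; exact: tail_anti.
Qed.

Definition ramp (c e x : R) : R := Num.max 0 (Num.min 1 ((x - c) / e)).

Lemma ramp_range c e x : 0 <= ramp c e x <= 1.
Proof. by rewrite /ramp le_max lexx ge_max ler01 ge_min lexx. Qed.

Lemma ramp_Cb c e : Cb (ramp c e).
Proof.
split; last by exists 1 => x; have /andP[h1 h2] := ramp_range c e x; rewrite ger0_norm.
move=> x; apply: (continuous_max (f := cst 0) (g := fun x => Num.min 1 ((x - c) / e))).
  exact: cst_continuous.
apply: (continuous_min (f := cst 1) (g := fun x => (x - c) / e)).
  exact: cst_continuous.
apply: cvgM; last exact: cvg_cst.
by apply: cvgB; [exact: cvg_id | exact: cvg_cst].
Qed.

Lemma ramp_tail nu c e : 0 < e ->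
  tail nu (c + e) <= pairing nu (ramp c e) <= tail nu c.
Proof.
move=> e0.
have intr := bounded_meas_integrable nu (Cb_bounded_meas (ramp_Cb c e)).
have int1 (a : R) : nu.-integrable setT (EFin \o (\1_`[a, +oo[ : R -> R)).
  exact: indic_integrable.
rewrite /tail -!pairing_indic//; apply/andP; split.
  apply: le_Rintegral => // x _; rewrite indic_ray; case: (leP (c + e) x) => cx /=.
    rewrite /ramp le_max le_min lexx /= ler_pdivlMr// mul1r; lra.
  by have /andP[] := ramp_range c e x.
apply: le_Rintegral => // x _; rewrite indic_ray; case: (leP c x) => cx /=.
  by have /andP[] := ramp_range c e x.
by rewrite /ramp ge_max lexx ge_min pmulr_lle0 ?invr_gt0// subr_le0 (ltW cx) orbT.
Qed.

(** The indicator of the ray lies between a ramp ending at [c] and one starting at [c]. Weak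
    convergence passes through the ramps, and continuity at [c] of the tail of the limit makes the
    two bounds meet. *)
Lemma tail_cvg (nus : nat -> {finite_measure set R -> \bar R}) nu :
  (forall x, nu [set x] = 0%E) ->
  (forall f, Cb f -> pairing (nus k) f @[k --> \oo] --> pairing nu f) ->
  forall c, tail (nus k) c @[k --> \oo] --> tail nu c.
Proof.
move=> na cf c; apply/cvgrPdist_le => e e0.
have e2 : 0 < e / 2 by rewrite divr_gt0.
have [d1 d10 h1] := tail_cvg_left nu c e2.
have [d2 d20 h2] := tail_cvg_right (na c) e2.
near=> k.
have b1 : `|pairing nu (ramp (c - d1) d1) - pairing (nus k) (ramp (c - d1) d1)| <= e / 2.
  by near: k; apply: cvgr_dist_le => //; apply: cf; exact: ramp_Cb.
have b2 : `|pairing nu (ramp c d2) - pairing (nus k) (ramp c d2)| <= e / 2.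
  by near: k; apply: cvgr_dist_le => //; apply: cf; exact: ramp_Cb.
have /andP[_ r1] := ramp_tail nu (c - d1) d10.
have /andP[r2 _] := ramp_tail (nus k) (c - d1) d10.
have /andP[r3 _] := ramp_tail nu c d20.
have /andP[_ r4] := ramp_tail (nus k) c d20.
rewrite subrK in r2.
move: b1 b2; rewrite !ler_norml => /andP[? ?] /andP[? ?]; apply/andP; split; lra.
Unshelve. all: end_near. Qed.

End TailLimits.

(** * Tails, mass and tightness of the fluid limit *)

Section FluidTails.
Variables (R : realType) (mu : {finite_measure set R -> \bar R}).
Variables (al : probability R R) (lam : R).
Hypothesis (lam0 : 0 <= lam).

Lemma fluid_limit_tail a t : tail (fluid_limit mu al lam t) (a - t) =
  tail mu a + lam * tail_integral al a t.
Proof.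
have [nu nuE] := fin_meas_finite (fluid_limit_fin_meas mu al lam0 t).
rewrite (eq_tail _ nuE) /tail -!pairing_indic// -(eq_pairing _ nuE).
rewrite (@pairing_fluid_limit _ mu al lam lam0 t _ 1)//; last first.
  by move=> x; rewrite indic_ray; case: (_ <= x); rewrite ?normr0 ?normr1.
congr (_ + _).
  by congr (pairing _ _); apply/funext => x; rewrite !indic_ray lerD2r.
rewrite /tail_integral; congr (_ * fine _); apply: eq_integral => s _; congr (_%:E).
rewrite /tail -pairing_indic//; congr (pairing _ _); apply/funext => x.
by rewrite !indic_ray lerBrDr.
Qed.

Lemma integral_cst_itv (t : R) : 0 <= t ->
  fine (\int[lebesgue_measure]_(s in `[0%R, t]%classic) (1%R)%:E)%E = t.
Proof.
move=> t0; rewrite integral_cst//= lebesgue_measure_itv/= lte_fin mul1e.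
by move: t0; rewrite le_eqVlt => /predU1P[<-|->]; rewrite ?ltxx//= subr0.
Qed.

Lemma fluid_limit_mass t : 0 <= t -> mass (fluid_limit mu al lam t) = mass mu + lam * t.
Proof.
move=> t0; have [nu nuE] := fin_meas_finite (fluid_limit_fin_meas mu al lam0 t).
rewrite (eq_mass nuE) /mass -!pairing_indic// -(eq_pairing _ nuE).
rewrite (@pairing_fluid_limit _ mu al lam lam0 t _ 1)//; last first.
  by move=> x; rewrite indicT normr1.
have E1 u : (fun x : R => \1_[set: R] (x - u)) = \1_[set: R] :> (R -> R).
  by apply/funext => x; rewrite !indicT.
rewrite E1; congr (_ + _ * _).
rewrite -[RHS](integral_cst_itv t0); congr fine; apply: eq_integral => s _; congr (_%:E).
rewrite pairing_indic//; exact: mass_prob.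
Qed.

Hypothesis al0 : forall c, c <= 0 -> tail al c = 1.

Lemma tail_integral_nonpos a t : a <= 0 -> 0 <= t -> tail_integral al a t = t.
Proof.
move=> a0 t0; rewrite /tail_integral -[RHS](integral_cst_itv t0); congr fine.
apply: eq_integral => s; rewrite inE/= in_itv/= => /andP[s0 st].
by rewrite al0//; lra.
Qed.

Lemma tail_integral_le a t Tm : 0 <= t <= Tm -> tail_integral al a t <= Tm * tail al (a - Tm).
Proof.
move=> /andP[t0 tT].
have intc (r : R) : lebesgue_measure.-integrable (`[0%R, t]%classic : set (measurableTypeR R))
    (EFin \o (cst r : measurableTypeR R -> R)).
  apply: measurable_bounded_integrable => //; first exact: lebesgue_itv_fin.
  by exists `|r|; split => [|x Mr y _]; [exact: num_real | exact: ltW].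
have intk : lebesgue_measure.-integrable (`[0%R, t]%classic : set (measurableTypeR R))
    (EFin \o (fun s : measurableTypeR R => tail al (a - t + s))).
  apply: measurable_bounded_integrable => //; first exact: lebesgue_itv_fin.
    apply: measurable_funTS; exact: measurable_tail_shift.
  exists 1; split => [|r r1 x _]; first exact: num_real.
  suff : `|tail al (a - t + x)| <= r by [].
  by rewrite ger0_norm ?tail_ge0// (le_trans (tail_prob_le1 _ _))// ltW.
have -> : tail_integral al a t = \int[lebesgue_measure]_(s in `[0%R, t]%classic)
   (fun s : measurableTypeR R => tail al (a - t + s)) s by [].
apply: (@le_trans _ _ (\int[lebesgue_measure]_(s in `[0%R, t]%classic)
   (cst (tail al (a - Tm)) : measurableTypeR R -> R) s)).
  apply: le_Rintegral => // s /=; rewrite in_itv/= => /andP[s0 st].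
  by apply: tail_anti; lra.
rewrite Rintegral_cst//= mulrC ler_wpM2r ?tail_ge0//.
rewrite lebesgue_measure_itv/= lte_fin; case: ltP => _ /=; rewrite ?subr0//.
exact: le_trans tT.
Qed.

(** At the shifted threshold [-K] all arrivals count, as services are nonnegative; their mass
    [lam * t] cancels and only the left tail of [mu] is left. On the right the arrivals up to [Tm]
    contribute at most [lam * Tm * tail al (K - Tm)]. *)
Lemma fluid_limit_tight (Tm e : R) : 0 < e -> exists K : nat, forall t, 0 <= t <= Tm ->
  mass (fluid_limit mu al lam t) - tail (fluid_limit mu al lam t) (- K%:R - t) +
  tail (fluid_limit mu al lam t) (K%:R - t) <= e.
Proof.
move=> e0; have e3 : 0 < e / 3 by rewrite divr_gt0.
have [A1 h1] := tail_pinfty mu e3; have [A2 h2] := tail_ninfty mu e3.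
have [Tm0|Tm0] := ltP Tm 0.
  by exists 0%N => t /andP[t0 tT]; have := le_lt_trans t0 (le_lt_trans tT Tm0); rewrite ltxx.
have den0 : 0 < lam * Tm + 1 by rewrite ltr_wpDl// mulr_ge0.
have e4 : 0 < e / 3 / (lam * Tm + 1) by rewrite divr_gt0.
have [A3 h3] := tail_pinfty al e4.
exists (Num.truncn (`|A1| + `|A2| + `|A3| + Tm)).+1 => t tT.
set K : R := _.+1%:R.
have KA : `|A1| + `|A2| + `|A3| + Tm < K by exact: truncnS_gt.
have m1 := ler_norm A1; have m2 := ler_norm (- A2); have m3 := ler_norm A3.
have n1 := normr_ge0 A1; have n2 := normr_ge0 A2; have n3 := normr_ge0 A3; rewrite normrN in m2.
case/andP: (tT) => t0 tT'.
rewrite fluid_limit_mass// !fluid_limit_tail (@tail_integral_nonpos (- K))//; last by lra.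
have b1 : tail mu K <= e / 3 by apply: h1; lra.
have b2 : mass mu - tail mu (- K) <= e / 3 by apply: h2; lra.
have b3 : lam * tail_integral al K t <= e / 3.
  rewrite (le_trans (ler_wpM2l lam0 (tail_integral_le K tT)))//.
  have t3 : tail al (K - Tm) <= e / 3 / (lam * Tm + 1) by apply: h3; lra.
  rewrite mulrA (le_trans (ler_wpM2l (mulr_ge0 lam0 Tm0) t3))//.
  rewrite mulrCA ler_piMr ?(ltW e3)// ler_pdivrMr//; lra.
lra.
Qed.

End FluidTails.

(** * From pathwise convergence to convergence in distribution *)

Section Principle.
Context {R : realType} {d : measure_display} {T : measurableType d}.
Variable P : probability T R.

(* No measurability of [g]: the integral of a non-measurable function is the
   difference of the lower integrals of its positive and negative parts. *)
Lemma le_integral_raw (g h : T -> R) : (forall w, g w <= h w) ->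
  (\int[P]_w (g w)%:E <= \int[P]_w (h w)%:E)%E.
Proof.
move=> gh; rewrite /integral; apply: leeB; apply: le_ereal_sup => _ /= [f fle <-];
  exists f => //= w; apply: le_trans (fle w) _; rewrite !patch_setT /=.
- by rewrite !funeposE le_max2// lee_fin.
- by rewrite !funenegE le_max2// leeN2 lee_fin.
Qed.

Let good (Om : set T) (Z : nat -> T -> R) (z : nat -> R) (r : R) (m : nat) :=
  [set w | Om w /\ forall q, (q < m)%N -> `|Z q w - z q| <= r].

Let good_prob (Om : nat -> set T) (Z : nat -> nat -> T -> R) (z : nat -> R) (r del : R) m :
  (forall k, measurable (Om k)) -> (forall k, P (Om k) = 1%E) ->
  (forall q k, measurable_fun setT (Z q k)) -> (forall q, cvg_pr P (Z q) (z q)) ->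
  0 < r -> 0 < del ->
  \forall k \near \oo, measurable (good (Om k) (Z ^~ k) z r m) /\
    (P (~` good (Om k) (Z ^~ k) z r m) <= del%:E)%E.
Proof.
move=> mOm POm mZ cZ r0; elim: m del => [|m IH] del del0.
  near=> k; have -> : good (Om k) (Z ^~ k) z r 0 = Om k by apply/seteqP; split => w //= [].
  by split => //; rewrite probability_setC// POm subee// lee_fin ltW.
have d2 : 0 < del / 2 by rewrite divr_gt0.
have := cZ m _ _ r0 d2; have := IH _ d2; apply: filterS2 => k [mg Pg] PZ.
set G := good _ _ _ _ _ in mg Pg *.
have mB := measurable_dist (z m) r (mZ m k).
set B := [set w | _] in PZ mB.
have gE : good (Om k) (Z ^~ k) z r m.+1 = G `&` ~` B.
  apply/seteqP; split => [w /= [Ow H]|w /= [[Ow H] /negP nB]].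
    split; first by split => // q qm; apply: H; rewrite ltnW.
    by apply/negP; rewrite -leNgt H.
  split => // q; rewrite ltnS leq_eqVlt => /predU1P[->|/H//].
  by rewrite leNgt.
rewrite gE; split; first by apply: measurableI => //; exact: measurableC.
rewrite setCI setCK.
have U := @measureU2 _ _ _ P _ _ (measurableC mg) mB.
by apply: (le_trans U); rewrite [del]splitr EFinD leeD.
Unshelve. all: end_near. Qed.

(* [F \o X k] need not be measurable. If [F (X k w)] did not approach [F x]
   uniformly on the events [good], a sequence of bad points of these events
   would contradict the pathwise convergence; [le_integral_raw] and the bound of [F] take
   care of the complements, of vanishing probability. *)
Lemma cvg_dist_good (X : nat -> T -> R -> fmeas R) (x : R -> fmeas R)
    (Om : nat -> set T) (Z : nat -> nat -> T -> R) (z : nat -> R) :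
  (forall k, measurable (Om k)) -> (forall k, P (Om k) = 1%E) ->
  (forall q k, measurable_fun setT (Z q k)) -> (forall q, cvg_pr P (Z q) (z q)) ->
  cadlag x -> (forall k w, Om k w -> cadlag (X k w)) ->
  (forall (s : nat -> nat) (w : nat -> T), (forall j, (j <= s j)%N) ->
     (forall j, Om (s j) (w j)) -> (forall q, Z q (s j) (w j) @[j --> \oo] --> z q) ->
     J1cvg (fun j => X (s j) (w j)) x) ->
  cvg_dist P X x.
Proof.
move=> mOm POm mZ cZ cx cX H F [[M0 FM0] Fc].
pose M := `|M0|.
have FM y : `|F y| <= M by rewrite (le_trans (FM0 y)) ?ler_norm.
have M_ge0 : 0 <= M by exact: normr_ge0.
(* One index [m] governs both the number of controlled variables and their precision. Points taken
   in [A (s m) m] therefore make every [Z q] converge at once. *)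
pose A k m := good (Om k) (Z ^~ k) z m.+1%:R^-1 m.
have key e : 0 < e -> exists m, forall k w, (m <= k)%N -> A k m w -> `|F (X k w) - F x| <= e.
  move=> e0; apply: contrapT => /forallNP nH.
  have /choice[sw Hsw] : forall m, exists kw : nat * T,
      [/\ (m <= kw.1)%N, A kw.1 m kw.2 & e < `|F (X kw.1 kw.2) - F x|].
    move=> m; have /existsNP[k /existsNP[w /not_implyP[mk /not_implyP[Aw /negP]]]] := nH m.
    by rewrite -ltNge => h; exists (k, w).
  pose s m := (sw m).1; pose w m := (sw m).2.
  have sm j : (j <= s j)%N by case: (Hsw j).
  have cs : forall q, Z q (s j) (w j) @[j --> \oo] --> z q.
    move=> q; apply/cvgrPdist_le => r r0; near=> j.
    have [_ [_ Hq] _] := Hsw j.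
    have qj : (q < j)%N by near: j; exact: nbhs_infty_gt.
    rewrite distrC (le_trans (Hq q qj))// invf_ple ?posrE//.
    apply: (@le_trans _ _ j%:R); last by rewrite ler_nat.
    by near: j; exact: nbhs_infty_ger.
  have J := H s w sm (fun j => let: And3 _ (conj a _) _ := Hsw j in a) cs.
  have cFF := Fc _ _ (fun j => cX _ _ (let: And3 _ (conj a _) _ := Hsw j in a)) cx J.
  have /filter_ex[j Hj] : \forall j \near \oo, `|F x - F (X (s j) (w j))| <= e.
    by apply: cvgr_dist_le.
  by have [_ _] := Hsw j; apply/negP; rewrite -leNgt distrC.
have main e : 0 < e -> \forall k \near \oo,
    ((F x - e)%:E <= \int[P]_w (F (X k w))%:E <= (F x + e)%:E)%E.
  move=> e0; have e2 : 0 < e / 2 by rewrite divr_gt0.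
  have [m Hm] := key _ e2.
  (* Off the good event [F] is wrong by at most [2 * M]; the added 1 keeps the quotient positive
     when [M = 0]. *)
  have M1 : 0 < 2 * M + 1 by rewrite ltr_wpDl// mulr_ge0.
  have del0 : 0 < e / 2 / (2 * M + 1) by rewrite divr_gt0.
  have r0 : 0 < (m.+1%:R^-1 : R) by rewrite invr_gt0.
  have := good_prob m mOm POm mZ cZ r0 del0.
  have : \forall k \near \oo, (m <= k)%N by exact: nbhs_infty_ge.
  apply: filterS2 => k mk [mA PA].
  set B := ~` _ in PA; have mB : measurable B by exact: measurableC.
  have PB : 2 * M * fine (P B) <= e / 2.
    have pb : fine (P B) <= e / 2 / (2 * M + 1).
      by rewrite -lee_fin fineK ?fin_num_measure.
    rewrite (le_trans (ler_wpM2l (mulr_ge0 (ler0n R 2) M_ge0) pb))//.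
    rewrite mulrCA ler_piMr ?(ltW e2)// ler_pdivrMr//; lra.
  have near_w w : ~ B w -> `|F (X k w) - F x| <= e / 2.
    by move=> /contrapT Aw; exact: Hm.
  (* The values -1 and 1 of [c] give the two integrable envelopes between which the possibly
     non-measurable integrand lies. *)
  have intI c : (\int[P]_w (F x + c * (e / 2 + 2 * M * \1_B w))%:E =
      (F x + c * (e / 2 + 2 * M * fine (P B)))%:E)%E.
    have i1 : P.-integrable setT (EFin \o (fun w => c * (2 * M) * (\1_B w : R))).
      exact: indicZ_integrable.
    have i2 : P.-integrable setT (EFin \o (fun=> F x + c * (e / 2))).
      exact: (@bounded_integrable _ _ _ P _ _ `|F x + c * (e / 2)|).
    have fE : (fun w => F x + c * (e / 2 + 2 * M * \1_B w)) =
        (fun w => (F x + c * (e / 2)) + c * (2 * M) * (\1_B w : R)).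
      by apply/funext => w; ring.
    have i3 : P.-integrable setT (EFin \o (fun w => F x + c * (e / 2 + 2 * M * \1_B w))).
      by rewrite fE; exact: (integrableD measurableT i2 i1).
    rewrite -[LHS]fineK; last exact: (integrable_fin_num measurableT i3).
    congr (_%:E); rewrite -/(Rintegral P setT (fun w => F x + c * (e / 2 + 2 * M * \1_B w))) fE.
    rewrite (RintegralD measurableT i2 i1) RintegralZl//; last exact: indic_integrable.
    have -> : \int[P]_w \1_B w = fine (P B) := Rintegral_indic P mB.
    have -> : \int[P]_w (fun=> F x + c * (e / 2)) w = F x + c * (e / 2).
      by rewrite Rintegral_cst//= probability_setT mulr1.
    ring.
  have FMx := FM x.
  have bnd w : F x + -1 * (e / 2 + 2 * M * \1_B w) <= F (X k w) <= F x + 1 * (e / 2 + 2 * M * \1_B w).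
    rewrite indicE; have [wB|wB] := boolP (w \in B).
      have := FM (X k w); move: FMx; rewrite /= !ler_norml => /andP[? ?] /andP[? ?].
      by apply/andP; split; lra.
    have := near_w w (fun h => negP wB (mem_set h)).
    by rewrite /= ler_norml => /andP[? ?]; apply/andP; split; lra.
  apply/andP; split.
    apply: (@le_trans _ _ (\int[P]_w (F x + -1 * (e / 2 + 2 * M * \1_B w))%:E)%E).
      by rewrite intI lee_fin; lra.
    by apply: le_integral_raw => w; case/andP: (bnd w).
  apply: (@le_trans _ _ (\int[P]_w (F x + 1 * (e / 2 + 2 * M * \1_B w))%:E)%E).
    by apply: le_integral_raw => w; case/andP: (bnd w).
  by rewrite intI lee_fin; lra.
apply/fine_cvgP; split.
  have := main 1 ltr01; apply: filterS => k /andP[h1 h2].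
  by rewrite fin_numE; apply/andP; split; apply/eqP => E; rewrite E in h1 h2.
apply/cvgrPdist_le => e e0; have := main e e0; apply: filterS => k /=.
case: (\int[P]_w _)%E => [r||] /andP[]; rewrite ?lee_fin//= => h1 h2.
by rewrite ler_norml; apply/andP; split; lra.
Unshelve. all: end_near. Qed.

End Principle.

(** * Uniform convergence of the paths along a sequence of sample points *)

Section PathConvergence.
Variables (R : realType) (T : Type) (mu0 : nat -> T -> fmeas R).
Variables (E sig : nat -> nat -> T -> R) (lam : R).
Variables (mu : {finite_measure set R -> \bar R}) (al : probability R R).
Hypothesis lam0 : 0 < lam.
Hypothesis al0 : forall c, c <= 0 -> tail al c = 1.

(* Number of arrivals expected before time [k.+1 * (l / q.+1)]. *)
Definition block_index k l q : nat :=
  Num.truncn (k.+1%:R * (lam * (l%:R / q.+1%:R)) : R).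

Definition scaled_arrival k w l q : R :=
  k.+1%:R^-1 * \sum_(i < block_index k l q) E k i w.

Definition scaled_count k w l q (c : R) : R :=
  k.+1%:R^-1 * \sum_(i < block_index k l q) (k.+1%:R * c <= sig k i w)%R%:R.

Lemma block_index0 k q : block_index k 0 q = 0%N.
Proof. by rewrite /block_index mul0r !mulr0 truncn0. Qed.

Lemma block_index_mono k q : {homo (fun l => block_index k l q) : l l' / (l <= l')%N >-> (l <= l')%N}.
Proof.
move=> l l' ll; apply: le_truncn; rewrite ler_pM2l// ler_pM2l//.
by rewrite ler_pM2r ?invr_gt0// ler_nat.
Qed.

Lemma block_index_cvg l q : ((block_index k l q)%:R / k.+1%:R : R) @[k --> \oo] --> lam * (l%:R / q.+1%:R).
Proof.
set x := lam * _; have x0 : 0 <= x by rewrite mulr_ge0 ?divr_ge0// ltW.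
apply/cvgrPdist_le => e e0; near=> k.
have k0 : 0 < (k.+1%:R : R) by rewrite ltr0n.
have kx0 : 0 <= k.+1%:R * x by rewrite mulr_ge0.
have /andP[h1 h2] := truncn_itv kx0.
have ke : k.+1%:R^-1 <= e.
  rewrite invf_ple ?posrE//; apply: (@le_trans _ _ k%:R); last by rewrite ler_nat.
  by near: k; exact: nbhs_infty_ger.
rewrite /block_index -/x; set n := Num.truncn _ in h1 h2 *.
have u : n%:R / k.+1%:R <= x by rewrite ler_pdivrMr// mulrC.
have v : x <= n%:R / k.+1%:R + k.+1%:R^-1.
  by rewrite -[X in _ + X]mul1r -mulrDl ler_pdivlMr// natr1 mulrC ltW.
move: u v ke; move: (k.+1%:R^-1) (n%:R / _) => z y ? ? ?.
by rewrite ler_norml; apply/andP; split; lra.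
Unshelve. all: end_near. Qed.

Variables (s : nat -> nat) (w : nat -> T).
Hypothesis fin0 : forall j, fin_meas (mu0 (s j) (w j)).
Hypothesis E0 : forall j i, 0 <= E (s j) i (w j).
Hypothesis sig0 : forall j i, 0 <= sig (s j) i (w j).
Hypothesis Einf : forall j n, exists2 i, (n <= i)%N & 1 < E (s j) i (w j).
Hypothesis mass0 : mass (nscale (s j).+1%:R (mu0 (s j) (w j))) @[j --> \oo] --> mass mu.
Hypothesis tail0 : forall a : rat,
  tail (nscale (s j).+1%:R (mu0 (s j) (w j))) (ratr a) @[j --> \oo] --> tail mu (ratr a).
Hypothesis Scvg : forall l q, scaled_arrival (s j) (w j) l q @[j --> \oo] --> (l%:R / q.+1%:R : R).
Hypothesis Vcvg : forall l q (c : rat), scaled_count (s j) (w j) l q (ratr c) @[j --> \oo] -->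
  lam * (l%:R / q.+1%:R) * tail al (ratr c).

Lemma departures_cvg (a : rat) (Tm e : R) : 0 < e ->
  \forall j \near \oo, exists K,
    (forall i, (K <= i)%N -> (s j).+1%:R * Tm < arrival (E (s j)) i (w j)) /\
    forall t, 0 <= t <= Tm ->
    `|departures_after (s j).+1%:R (fun i => E (s j) i (w j)) (fun i => sig (s j) i (w j)) K t (ratr a) -
      lam * tail_integral al (ratr a) t| <= e.
Proof.
move=> e0.
(* The mesh is chosen before the precision: [4 * lam * h] takes half of [e], and then [eta] gives
   the other half to the [L0] blocks. *)
pose q := Num.truncn (8 * lam / e).
pose h : R := q.+1%:R^-1.
have h0 : 0 < h by rewrite invr_gt0.
have hE : 4 * lam * h <= e / 2.
  have : 8 * lam / e < q.+1%:R by exact: truncnS_gt.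
  rewrite ltr_pdivrMr// => /ltW qe.
  rewrite /h ler_pdivrMr//; lra.
(* The successor taken twice gives [Tm < (L0 - 1) * h]: the end of the last block, known up to [h],
   falls beyond [Tm]. *)
pose L0 := (Num.truncn (Tm / h)).+2.
have L0T : Tm < (L0%:R - 1) * h.
  by rewrite -ltr_pdivrMr// /L0 -natr1 addrK truncnS_gt.
have L0gt : 0 < (L0%:R : R) by rewrite ltr0n.
pose eta := e / (4 * L0%:R).
have eta0 : 0 < eta by rewrite divr_gt0// mulr_gt0.
have etaE : 2 * eta * L0%:R = e / 2.
  by rewrite /eta; field; rewrite gt_eqF.
(* These shifted thresholds are rational because [h] is, so finitely many of the assumed limits
   suffice. *)
pose c (m : nat) : rat := a - (m%:R - 1) / q.+1%:R.
have cE m : ratr (c m) = ratr a - (m%:R - 1) * h :> R.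
  by rewrite /c rmorphB /= fmorph_div rmorphB /= !rmorph_nat rmorph1.
have N1 : \forall j \near \oo, forall l : 'I_L0.+1,
    `|(l%:R / q.+1%:R : R) - scaled_arrival (s j) (w j) l q| <= h.
  by apply: filter_forall => l; apply: cvgr_dist_le => //; exact: Scvg.
have N2 : \forall j \near \oo, forall (l : 'I_L0.+1), forall (m : 'I_(L0 + 4)),
    `|lam * (l%:R / q.+1%:R) * tail al (ratr (c m)) - scaled_count (s j) (w j) l q (ratr (c m))| <= eta.
  apply: filter_forall => l; apply: filter_forall => m.
  by apply: cvgr_dist_le => //; exact: Vcvg.
move: N1 N2; apply: filterS2 => j N1 N2.
have N0 : 0 < ((s j).+1%:R : R) by rewrite ltr0n.
have Sh l : (l <= L0)%N ->
    `|(s j).+1%:R^-1 * (\sum_(i < block_index (s j) l q) E (s j) i (w j)) - l%:R * h| <= h.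
  by move=> lL; have := N1 (Ordinal (lL : (l < L0.+1)%N)); rewrite distrC.
have b0 := block_index0 (s j) q; have bm := @block_index_mono (s j) q.
exists (block_index (s j) L0 q); split => [i|t tT].
  exact: (arrival_after_horizon (idx := fun l => block_index (s j) l q) N0 (E0 j) Sh L0T).
apply: (@le_trans _ _ (4 * lam * h + 2 * eta * L0%:R)); last by rewrite etaE; lra.
apply: (@departures_close _ _ _ _ (fun l => block_index (s j) l q) N0 (E0 j) b0 bm h L0 h0 Sh
  al lam eta (ratr a) Tm (ltW lam0) (ltW eta0)) => //.
move=> l m lL mL.
have mL' : (m < L0 + 4)%N by rewrite addnS ltnS.
have := N2 (Ordinal (lL : (l < L0.+1)%N)) (Ordinal mL').
by rewrite distrC /= cE.
Qed.

Lemma path_cvg (f : R -> R) (Tm e : R) : Cb f -> 0 < Tm -> 0 < e ->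
  \forall j \near \oo, forall t, 0 <= t <= Tm ->
  `|pairing (nprofile (s j).+1%:R (mu0 (s j)) (E (s j)) (sig (s j)) (w j) t) f -
    pairing (fluid_limit mu al lam t) f| <= e.
Proof.
move=> Cbf Tm0 e0.
have N0 j : 0 < ((s j).+1%:R : R) by rewrite ltr0n.
have lam0' := ltW lam0.
pose X j := nprofile (s j).+1%:R (mu0 (s j)) (E (s j)) (sig (s j)) (w j).
apply: (@unif_pairing_cvg _ X _ Tm (mass mu + lam * Tm)) => //.
- move=> j t /andP[t0 _].
  by have [+ _] := nprofile_cadlag (sig (s j)) (N0 j) (fin0 j) (E0 j) (Einf j); apply.
- by move=> t _; exact: fluid_limit_fin_meas.
- move=> a r r0; have r2 : 0 < r / 2 by rewrite divr_gt0.
  have T0 : \forall j \near \oo, `|tail mu (ratr a) - tail (nscale (s j).+1%:R (mu0 (s j) (w j))) (ratr a)| <= r / 2.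
    by apply: cvgr_dist_le => //; exact: tail0.
  have := departures_cvg a Tm r2; move: T0; apply: filterS2 => j T0 [K [KT HK]] t tT.
  have Kt i : (K <= i)%N -> (s j).+1%:R * t < arrival (E (s j)) i (w j).
    by move=> /KT; apply: le_lt_trans; rewrite ler_pM2l//; case/andP: tT.
  rewrite /X (nprofile_tail (sig (s j)) (N0 j) (fin0 j) (ratr a) Kt) fluid_limit_tail//.
  have := HK t tT; move: T0.
  move: (tail mu _) (tail (nscale _ _) _) (departures_after _ _ _ _ _ _) (lam * _) => x1 x2 x3 x4.
  by rewrite !ler_norml => /andP[? ?] /andP[? ?]; apply/andP; split; lra.
- move=> r r0; have r2 : 0 < r / 2 by rewrite divr_gt0.
  have T0 : \forall j \near \oo, `|mass mu - mass (nscale (s j).+1%:R (mu0 (s j) (w j)))| <= r / 2.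
    by apply: cvgr_dist_le.
  have := departures_cvg 0 Tm r2; move: T0; apply: filterS2 => j T0 [K [KT HK]] t tT.
  have Kt i : (K <= i)%N -> (s j).+1%:R * t < arrival (E (s j)) i (w j).
    by move=> /KT; apply: le_lt_trans; rewrite ler_pM2l//; case/andP: tT.
  case/andP: (tT) => t0 _.
  rewrite /X (nprofile_mass (N0 j) (fin0 j) (E0 j) (sig0 j) Kt) fluid_limit_mass//.
  have := HK t tT; rewrite rmorph0 (tail_integral_nonpos al0)//; move: T0.
  move: (mass mu) (mass (nscale _ _)) (departures_after _ _ _ _ _ _) (lam * _) => x1 x2 x3 x4.
  by rewrite !ler_norml => /andP[? ?] /andP[? ?]; apply/andP; split; lra.
- move=> t /andP[t0 tT]; rewrite fluid_limit_mass// lerD2l ler_wpM2l//.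
- by move=> r r0; exact: fluid_limit_tight.
Qed.

(** The convergence is uniform on compact time intervals, so the identity serves as time change. *)
Lemma path_J1cvg : J1cvg (fun j => nprofile (s j).+1%:R (mu0 (s j)) (E (s j)) (sig (s j)) (w j))
  (fluid_limit mu al lam).
Proof.
exists (fun _ => id); split => [_|].
  split => //; split => //; split; first by apply: continuous_subspaceT => x; exact: cvg_id.
  by split => // u u0; exists u.
split=> [Tm e T0 e0|f Cbf Tm e Tm0 e0]; last exact: path_cvg.
by near=> k => t _ /=; rewrite subrr normr0 ltW.
Unshelve. all: end_near. Qed.

End PathConvergence.

(** * Test functions in [Db] *)

Section Indicators.
Variable R : realType.

(** A ray closed on the left has a right-continuous indicator, so assumption (iii) applies to it
    directly and yields the tails of the initial profile even at atoms of the limit. *)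
Lemma Db_ray (a : R) : Db (\1_`[a, +oo[ : R -> R).
Proof.
split; first by exists 1 => x; rewrite indic_ray; case: (a <= x); rewrite ?normr0 ?normr1.
split=> x.
  apply: cvg_near_cst; rewrite !indic_ray; have [ax|xa] := leP a x.
    near=> y; rewrite indic_ray; suff -> : a <= y by [].
    by apply: le_trans ax _; near: y; exact: nbhs_right_ge.
  near=> y; rewrite indic_ray; suff -> : (a <= y) = false by [].
  by apply/negbTE; rewrite -ltNge; near: y; exact: nbhs_right_lt.
have [ax|xa] := ltP a x.
  apply: (cvgP (1 : R)); apply: cvg_near_cst; near=> y; rewrite indic_ray.
  by suff -> : a <= y by []; near: y; exact: nbhs_left_ge.
apply: (cvgP (0 : R)); apply: cvg_near_cst; near=> y; rewrite indic_ray.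
have yx : y < x by near: y; exact: nbhs_left_lt.
suff -> : (a <= y) = false by [].
by apply/negbTE; rewrite -ltNge (lt_le_trans yx).
Unshelve. all: end_near. Qed.

Lemma Db_one : Db (\1_[set: R] : R -> R).
Proof.
have E x : \1_[set: R] x = 1 :> R by rewrite indicT.
split; first by exists 1 => x; rewrite E normr1.
by split=> x; [rewrite E | apply: (cvgP (1 : R))]; apply: cvg_near_cst; near=> y; rewrite E.
Unshelve. all: end_near. Qed.

Lemma Db_bounded_meas (f : R -> R) : Db f -> bounded_meas f.
Proof. by move=> [bf [rf _]]; split => //; exact: right_continuous_measurable. Qed.

End Indicators.

(** * Events of probability one *)

Section ProbabilityOne.
Context {R : realType} {d : measure_display} {T : measurableType d}.
Variable P : probability T R.

Lemma prob_bigcap1 (A : nat -> set T) : (forall n, measurable (A n)) ->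
  (forall n, P (A n) = 1%E) -> P (\bigcap_n A n) = 1%E.
Proof.
move=> mA PA; have mI : measurable (\bigcap_n A n) by exact: bigcapT_measurable.
have nC : P.-negligible (~` \bigcap_n A n).
  rewrite setC_bigcap; apply: negligible_bigcup => n.
  apply/negligibleP; first exact: measurableC.
  have E : P (~` A n) = 0%E by rewrite probability_setC// PA subee.
  exact: E.
have h0 : P (~` \bigcap_n A n) = 0%E by apply/negligibleP => //; exact: measurableC.
have h : (1 - P (\bigcap_n A n) = 0)%E by rewrite -probability_setC.
rewrite -[LHS]fineK ?fin_num_measure//; congr (_%:E).
move: h; rewrite -[X in (_ - X)%E]fineK ?fin_num_measure// -EFinB => -[]; lra.
Qed.

Lemma prob_setI1 (A B : set T) : measurable A -> measurable B ->
  P A = 1%E -> P B = 1%E -> P (A `&` B) = 1%E.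
Proof.
move=> mA mB PA PB.
have -> : A `&` B = \bigcap_n (if n == 0%N then A else B).
  apply/seteqP; split => [w [Aw Bw] n _|w H]; first by case: ifP.
  by split; [exact: (H 0%N) | exact: (H 1%N)].
by apply: prob_bigcap1 => n; case: ifP.
Qed.

(** By independence the [m] variables of index [n] onwards are all at most 1 with probability
    [q ^+ m], which tends to 0. The injection [f] selects the interarrival times inside the joint
    family of interarrivals and services. *)
Lemma infinitely_often_gt1 (I : eqType) (X : I -> T -> R) (f : nat -> I) (lam : R) (n : nat) :
  injective f -> 0 < lam -> mutual_indep P X ->
  (forall i, measurable_fun setT (X (f i))) -> (forall i, exp_law P lam (X (f i))) ->
  P (\bigcup_(i in [set i | (n <= i)%N]) [set w | 1 < X (f i) w]) = 1%E.
Proof.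
move=> injf lam0 indX mX lX.
set B := \bigcup_(i in _) _.
have mgt i : measurable [set w | 1 < X (f i) w].
  by rewrite -[Y in measurable Y]setTI; exact: measurable_fun_ltr.
have mB : measurable B by apply: bigcup_measurable => i _.
pose q := 1 - expR (- lam).
have q0 : 0 <= q by rewrite /q subr_ge0 -[leRHS]expR0 ler_expR oppr_le0 ltW.
have q1 : q < 1 by rewrite /q ltrBlDr ltrDl expR_gt0.
have bound m : (P (~` B) <= (q ^+ m)%:E)%E.
  pose l := [seq f i | i <- iota n m].
  have ul : uniq l by rewrite map_inj_uniq ?iota_uniq.
  pose C := \big[setI/setT]_(i <- l) (X i @^-1` `]-oo, 1]).
  have PC : P C = (q ^+ m)%:E.
    rewrite /C (indX l (fun=> `]-oo, 1]%classic))// /l big_map.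
    elim: (m) (n) => [|m' IH] n'; first by rewrite big_nil.
    rewrite big_cons IH exprS EFinM; congr (_ * _)%E.
    rewrite (_ : _ @^-1` _ = [set w | X (f n') w <= 1]).
      by rewrite lX ler01 mulr1.
    by apply/seteqP; split => w /=; rewrite in_itv.
  have mC : measurable C.
    rewrite /C /l big_map; elim: (iota n m) => [|i r IH]; first by rewrite big_nil.
    rewrite big_cons; apply: measurableI => //.
    by rewrite -[Y in measurable Y]setTI; exact: (mX i measurableT).
  rewrite -PC; apply: le_measure; rewrite ?inE//; first exact: measurableC.
  move=> w nBw; rewrite /C /l big_map.
  have H i : (n <= i)%N -> X (f i) w <= 1.
    by move=> ni; rewrite leNgt; apply/negP => h; apply: nBw; exists i.
  have : all (fun i => n <= i)%N (iota n m) by apply/allP => i; rewrite mem_iota => /andP[].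
  elim: (iota n m) => [|i r IH] /=; first by rewrite big_nil.
  move=> /andP[ni nr]; rewrite big_cons; split; last exact: IH.
  by rewrite /= in_itv/= H.
have PB0 : P (~` B) = 0%E.
  apply/eqP; rewrite eq_le measure_ge0 andbT.
  have cq : (q ^+ m) @[m --> \oo] --> (0 : R).
    by apply: cvg_expr; rewrite ger0_norm.
  rewrite -[X in (X <= _)%E]fineK ?fin_num_measure//; last exact: measurableC.
  rewrite lee_fin; apply: (cvgr_to_ge cq); near=> m.
  by rewrite -lee_fin fineK ?fin_num_measure//; exact: measurableC.
rewrite -[B]setCK probability_setC ?PB0 ?sube0//; exact: measurableC.
Unshelve. all: end_near. Qed.

Lemma cvg_pr_of_cvge (Z : nat -> T -> R) (z : R) :
  (forall e : R, 0 < e -> P [set w | (e < `|Z k w - z|)%R] @[k --> \oo] --> 0%E) ->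
  cvg_pr P Z z.
Proof.
move=> h e del e0 del0; have /fine_cvgP[fn cf] := h e e0.
have : \forall k \near \oo, `|0 - fine (P [set w | e < `|Z k w - z|])| <= del.
  by apply: cvgr_dist_le.
move: fn; apply: filterS2 => k fk; rewrite sub0r normrN => hk.
by rewrite -[leLHS]fineK// lee_fin (le_trans (ler_norm _)).
Qed.

End ProbabilityOne.

(** * Scaled service laws *)

Section Laws.
Variable R : realType.

Lemma nlaw_tail (N : R) (a : probability R R) : 0 < N -> exists nu : {finite_measure set R -> \bar R},
  (forall B, measurable B -> nlaw N a B = nu B) /\
  (forall c, tail nu c = fine (a `[N * c, +oo[%classic)).
Proof.
move=> N0; have mdiv : measurable_fun setT (fun y : R => y / N) by exact: measurable_funM.
have [nu [nuE _]] := ex_pushforward a mdiv.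
exists nu; split => [B mB|c]; first by rewrite /nlaw scaled_preimage// nuE.
rewrite /tail nuE//; congr (fine (a _)); apply/seteqP; split => y /=;
  by rewrite !in_itv/= !andbT ler_pdivlMr// mulrC.
Qed.

Lemma nonneg_tail1 (a : probability R R) (c : R) : a [set x | x < 0] = 0%E -> c <= 0 ->
  fine (a `[c, +oo[%classic) = 1.
Proof.
move=> a0 c0.
have h0 : a `[0, +oo[%classic = 1%E.
  rewrite -[X in a X]setCK probability_setC; last exact: measurableC.
  rewrite (_ : ~` _ = [set x | x < 0]) ?a0 ?sube0//.
  by apply/seteqP; split => x /=; rewrite in_itv/= andbT; [move/negP; rewrite -ltNge | move=> ?; apply/negP; rewrite -ltNge].
apply/eqP; rewrite eq_le; apply/andP; split.
  by rewrite -lee_fin fineK ?fin_num_measure// probability_le1.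
rewrite -lee_fin fineK ?fin_num_measure// -h0; apply: le_measure; rewrite ?inE// => x /=.
by rewrite !in_itv/= !andbT; exact: le_trans.
Qed.

End Laws.

(* The n-th system (n in N^* ) is indexed by k : nat with n = k.+1. *)
Theorem theorem2 (R : realType) (d : measure_display) (T : measurableType d)
  (P : probability T R)
  (lam : nat -> R) (alpha : nat -> probability R R)
  (mu0 : nat -> T -> fmeas R) (E sig : nat -> nat -> T -> R)
  (lamstar : R) (mu0star : {finite_measure set R -> \bar R})
  (alphastar : probability R R) :
  (* the n-th M/GI/oo system *)
  (forall k, 0 < lam k) ->
  (forall k, forall x : R, alpha k [set x] = 0%E) ->
  (forall k, alpha k [set x : R | x < 0] = 0%E) ->
  (forall k, (alpha k).-integrable setT (fun x : R => x%:E)) ->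
  (forall k, random_fmeas (mu0 k)) ->
  (forall k i, measurable_fun setT (E k i)) ->
  (forall k i, measurable_fun setT (sig k i)) ->
  (forall k i, exp_law P (lam k) (E k i)) ->
  (forall k i B, measurable B -> P (sig k i @^-1` B) = alpha k B) ->
  (forall k, mutual_indep P
     (fun j : nat + nat => match j with inl i => E k i | inr i => sig k i end)) ->
  (* (i) *)
  0 < lamstar -> lam k @[k --> \oo] --> lamstar ->
  (* (ii) *)
  (forall eps : R, 0 < eps -> exists M : R, 0 < M /\ forall k,
     (P [set w | ((k.+1%:R * M)%:E < mu0 k w setT)%E] <= eps%:E)%E) ->
  (* (iii) *)
  mu0star.-integrable setT (fun x : R => x%:E) ->
  (forall f, Db f -> forall e : R, 0 < e ->
     P [set w | e < `|pairing (nscale k.+1%:R (mu0 k w)) f - pairing mu0star f|]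
       @[k --> \oo] --> 0%E) ->
  (* (iv) *)
  (forall x : R, alphastar [set x] = 0%E) ->
  (forall f, Cb f ->
     pairing (nlaw k.+1%:R (alpha k)) f @[k --> \oo] --> pairing alphastar f) ->
  alphastar.-integrable setT (fun x : R => x%:E) ->
  (\int[nlaw k.+1%:R (alpha k)]_x x%:E)%E @[k --> \oo] -->
     (\int[alphastar]_x x%:E)%E ->
  (* conclusion *)
  exists mustar : R -> fmeas R,
    (forall t, 0 <= t -> fin_meas (mustar t)) /\
    (forall f, Cb f ->
       {within [set t : R | 0 <= t], continuous (fun t => pairing (mustar t) f)}) /\
    (forall t, 0 <= t -> forall phi, Db phi ->
       pairing (mustar t) phi =
         pairing mu0star (fun x => phi (x - t)) +
         lamstar * fine (\int[lebesgue_measure]_(s in `[0%R, t]%classic)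
                           (pairing alphastar (fun x => phi (x - s)))%:E)%E) /\
    cvg_dist P (fun k w => nprofile k.+1%:R (mu0 k) (E k) (sig k) w) mustar.
Proof.
move=> lam_gt0 _ alpha0 _ rmu0 mE msig lE lsig indep ls0 lam_cvg _ _ mu0_cvg na alpha_cvg _ _.
have ls0' := ltW ls0.
have N0 k : 0 < (k.+1%:R : R) by rewrite ltr0n.
exists (fluid_limit mu0star alphastar lamstar).
split; first by move=> t _; exact: fluid_limit_fin_meas.
have cont f : Cb f -> continuous (fun t => pairing (fluid_limit mu0star alphastar lamstar t) f).
  by move=> Cbf; exact: pairing_fluid_limit_continuous.
split; first by move=> f Cbf; apply: continuous_subspaceT => t; exact: cont.
split.
  move=> t _ phi /Db_bounded_meas[mphi [M phiM]].
  exact: (@pairing_fluid_limit _ mu0star alphastar lamstar ls0' t phi M).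
have /choice[nus Hnus] := fun k => nlaw_tail (alpha k) (N0 k).
have nus_tail k c : tail (nus k) c = fine (alpha k `[k.+1%:R * c, +oo[%classic).
  by case: (Hnus k).
have tails c : tail (nus k) c @[k --> \oo] --> tail alphastar c.
  apply: (@tail_cvg _ nus alphastar na) => f Cbf.
  rewrite (_ : (fun k => _) = (fun k => pairing (nlaw k.+1%:R (alpha k)) f)); first exact: alpha_cvg.
  by apply/funext => k; apply/esym/eq_pairing; case: (Hnus k).
(* Nonnegativity of the services passes to the limit law: at a nonpositive threshold every prelimit
   tail equals 1. *)
have al0 c : c <= 0 -> tail alphastar c = 1.
  move=> c0; apply: (cvg_unique _ (tails c)) => //.
  rewrite (_ : (fun k => _) = cst 1); first exact: cvg_cst.
  by apply/funext => k; rewrite nus_tail nonneg_tail1//= pmulr_rle0.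
(* The almost sure event on which the path is càdlàg and the counting estimates hold. *)
pose Om k := \bigcap_n ([set w | 0 < E k n w] `&` [set w | 0 <= sig k n w] `&`
  \bigcup_(i in [set i | (n <= i)%N]) [set w | 1 < E k i w]).
have mgt k i (x : R) : measurable [set w | x < E k i w].
  by rewrite -[Y in measurable Y]setTI; exact: measurable_fun_ltr.
have mge k i : measurable [set w | 0 <= sig k i w].
  by rewrite -[Y in measurable Y]setTI; exact: measurable_fun_ler.
have mub k n : measurable (\bigcup_(i in [set i | (n <= i)%N]) [set w | 1 < E k i w]).
  by apply: bigcup_measurable.
have mOm k : measurable (Om k).
  by apply: bigcapT_measurable => n; apply: measurableI => //; exact: measurableI.
have POm k : P (Om k) = 1%E.
  apply: prob_bigcap1 => n; first by apply: measurableI => //; exact: measurableI.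
  apply: prob_setI1 => //; first exact: measurableI.
    apply: prob_setI1 => //.
      by rewrite (exp_law_gt (mE k n) (lE k n) (lexx 0)) mulr0 oppr0 expR0.
    rewrite (_ : [set w | 0 <= sig k n w] = sig k n @^-1` `[0, +oo[); last first.
      by apply/seteqP; split => w /=; rewrite in_itv/= andbT.
    rewrite lsig// -[LHS]fineK ?fin_num_measure//; congr (_%:E).
    exact: nonneg_tail1 (alpha0 k) (lexx 0).
  pose X (j : nat + nat) := match j with inl i => E k i | inr i => sig k i end.
  have injl : injective (fun i : nat => inl i : nat + nat) by move=> i j [].
  have := infinitely_often_gt1 n injl (lam_gt0 k) (indep k).
  by apply => i; [exact: mE | exact: lE].
have fin0 k w : fin_meas (mu0 k w) by case: (rmu0 k).
have OmP k w : Om k w -> [/\ forall i, 0 <= E k i w, forall i, 0 <= sig k i w &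
    forall n, exists2 i, (n <= i)%N & 1 < E k i w].
  by move=> H; split => n; have [[h1 h2] [i ni h3]] := H n I; [exact: ltW | exact: h2 | exists i].
pose idx k l q := block_index lamstar k l q.
(* The countable family of controlled variables: initial mass ([None]), initial tails, block ends
   and block counts. Multiplying by [lam k] makes the interarrival times exponential of rate 1 for
   every [k]; the [max] with 0 makes the variables nonnegative everywhere and changes nothing on
   [Om k]. *)
pose Zf (i : option rat + nat * nat + nat * nat * rat) k w : R :=
  match i with
  | inl (inl None) => mass (nscale k.+1%:R (mu0 k w))
  | inl (inl (Some a)) => tail (nscale k.+1%:R (mu0 k w)) (ratr a)
  | inl (inr (l, q)) => k.+1%:R^-1 * \sum_(i < idx k l q) Num.max 0 (lam k * E k i w)
  | inr (l, q, c) => k.+1%:R^-1 *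
      \sum_(i < idx k l q) \1_[set w | k.+1%:R * ratr c <= sig k i w] w
  end.
pose zf (i : option rat + nat * nat + nat * nat * rat) : R :=
  match i with
  | inl (inl None) => mass mu0star
  | inl (inl (Some a)) => tail mu0star (ratr a)
  | inl (inr (l, q)) => lamstar * (l%:R / q.+1%:R)
  | inr (l, q, c) => lamstar * (l%:R / q.+1%:R) * tail alphastar (ratr c)
  end.
have mset k B : measurable B -> measurable_fun setT (fun w => fine (nscale k.+1%:R (mu0 k w) B)).
  move=> mB; apply: measurableT_comp => //; apply: measurable_funeM.
  case: (rmu0 k) => _; apply; rewrite scaled_preimage// -[Y in measurable Y]setTI.
  exact: (measurable_funM _ _ measurableT).
have msg k i (c : R) : measurable [set w | k.+1%:R * c <= sig k i w].
  by rewrite -[Y in measurable Y]setTI; exact: measurable_fun_ler.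
have mZf i k : measurable_fun setT (Zf i k).
  case: i => [[[a|]|[l q]]|[[l q] c]] /=.
  - exact: mset.
  - exact: mset.
  - apply: measurable_funM => //; apply: measurable_sum => i.
    by apply: measurable_maxr => //; exact: measurable_funM.
  - apply: measurable_funM => //; apply: measurable_sum => i.
    exact: measurable_indic.
have cZf i : cvg_pr P (Zf i) (zf i).
  have ray_cvg (B : set R) : measurable B -> Db (\1_B : R -> R) ->
      cvg_pr P (fun k w => fine (nscale k.+1%:R (mu0 k w) B)) (fine (mu0star B)).
    move=> mB DbB; apply: cvg_pr_of_cvge => e e0.
    rewrite (_ : (fun k => _) = (fun k => P [set w | e <
        `|pairing (nscale k.+1%:R (mu0 k w)) \1_B - pairing mu0star \1_B|])); first exact: mu0_cvg.
    apply/funext => k; congr (P _); apply/seteqP; split => w /=;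
      by have [mu1 mu1E] := nscale_fin_meas (N0 k) (fin0 k w);
        rewrite (eq_pairing _ mu1E) !pairing_indic// mu1E.
  case: i => [[[a|]|[l q]]|[[l q] c]] /=.
  - by apply: ray_cvg; [exact: measurable_itv | exact: Db_ray].
  - by apply: ray_cvg; [exact: measurableT | exact: Db_one].
  - have PU k i x : 0 <= x -> P [set w | x < lam k * E k i w] = (expR (- x))%:E.
      move=> x0; rewrite (_ : [set w | _] = [set w | x / lam k < E k i w]).
        by rewrite (exp_law_gt (mE k i) (lE k i)) ?divr_ge0// ?ltW// mulrC mulfVK// gt_eqF.
      by apply/seteqP; split => w /=; rewrite ltr_pdivrMr// mulrC.
    apply: (@lln_exp1 _ _ _ P (fun k i w => lam k * E k i w) (fun k => idx k l q)) => //.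
    + by move=> k i; exact: measurable_funM.
    + move=> k i j x x0 ij.
      have pre i' : [set w | x < lam k * E k i' w] = E k i' @^-1` `]x / lam k, +oo[.
        by apply/seteqP; split => w /=; rewrite in_itv/= andbT ltr_pdivrMr// mulrC.
      have := @mutual_indep_pair _ _ _ P _ _ (inl i) (inl j) `]x / lam k, +oo[%classic `]x / lam k, +oo[%classic (indep k).
      by rewrite -!pre !PU// -EFinM; apply.
    + exact: block_index_cvg.
  - pose A k i := [set w | k.+1%:R * ratr c <= sig k i w].
    have pre k i : A k i = sig k i @^-1` `[k.+1%:R * ratr c, +oo[.
      by apply/seteqP; split => w /=; rewrite in_itv/= andbT.
    have PA k i : P (A k i) = (tail (nus k) (ratr c))%:E.
      by rewrite pre lsig// nus_tail fineK// fin_num_measure.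
    apply: (@lln_indic _ _ _ P A (fun k => tail (nus k) (ratr c)) _ _ (fun k => idx k l q)) => //.
    + by move=> k i; exact: msg.
    + move=> k i j ij.
      have := @mutual_indep_pair _ _ _ P _ _ (inr i) (inr j) `[k.+1%:R * ratr c, +oo[%classic `[k.+1%:R * ratr c, +oo[%classic (indep k).
      by rewrite -!pre !PA EFinM; apply.
    + exact: block_index_cvg.
(* The family is enumerated by [pickle]; numbers that encode no index get the constant 0, which
   converges trivially. *)
pose Z n := if unpickle n is Some i then Zf i else (fun _ _ => 0).
pose z n := if unpickle n is Some i then zf i else 0.
apply: (@cvg_dist_good _ _ _ P _ _ Om Z z) => //.
- by move=> n k; rewrite /Z; case: unpickle => [i|].
- move=> n; rewrite /Z /z; case: unpickle => [i|]; first exact: cZf.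
  move=> e del e0 del0; near=> k.
  rewrite (_ : [set w | _] = set0) ?measure0 ?lee_fin ?ltW//.
  by apply/seteqP; split => w //=; rewrite subrr normr0 ltNge ltW.
- split; first by move=> t _; exact: fluid_limit_fin_meas.
  split=> [t _ f Cbf|t _].
    by apply: cvg_at_right_filter; exact: cont.
  exists (fluid_limit mu0star alphastar lamstar t); split; first exact: fluid_limit_fin_meas.
  by move=> f Cbf; apply: cvg_at_left_filter; exact: cont.
- move=> k w /OmP[E0 sig0 Einf].
  exact: nprofile_cadlag.
move=> s w sj Omw cZ.
have cZi i : Zf i (s j) (w j) @[j --> \oo] --> zf i.
  by have := cZ (pickle i); rewrite /Z /z pickleK.
have s_oo : s j @[j --> \oo] --> \oo.
  by move=> A [N _ HN]; exists N => // j Nj; apply: HN; exact: leq_trans Nj (sj j).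
have lam_s : lam (s j) @[j --> \oo] --> lamstar by exact: (cvg_comp _ _ s_oo lam_cvg).
apply: path_J1cvg => //.
- by move=> j i; have [] := OmP _ _ (Omw j).
- by move=> j i; have [] := OmP _ _ (Omw j).
- by move=> j n; have [] := OmP _ _ (Omw j).
- exact: (cZi (inl (inl None))).
- by move=> a; exact: (cZi (inl (inl (Some a)))).
- move=> l q; have := cZi (inl (inr (l, q))); rewrite /= => h.
  (* Dividing by [lam (s j)], which tends to [lamstar], turns the normalized sums back into the
     actual block ends. *)
  have h' := cvgM (cvgV (lt0r_neq0 ls0) lam_s) h.
  rewrite mulrA mulVf ?mul1r ?gt_eqF// in h'.
  apply: (cvg_trans _ (h' _ _)); apply: near_eq_cvg; near=> j.
  rewrite /scaled_arrival /= mulrCA; congr (_ * _).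
  have [E0 _ _] := OmP _ _ (Omw j).
  rewrite mulr_sumr; apply: eq_bigr => i _.
  have lE0 : 0 <= lam (s j) * E (s j) i (w j) by rewrite mulr_ge0// ltW.
  rewrite (max_idPr lE0) mulrA mulVf ?mul1r// gt_eqF//.
- move=> l q c; have := cZi (inr (l, q, c)); rewrite /= /scaled_count.
  rewrite (_ : (fun j => _ * \sum_(i < idx _ _ _) _) = (fun j => (s j).+1%:R^-1 *
    \sum_(i < block_index lamstar (s j) l q) ((s j).+1%:R * ratr c <= sig (s j) i (w j))%R%:R))//.
  apply/funext => j; congr (_ * _); apply: eq_bigr => i _; rewrite indicE.
  by congr (_%:R); congr nat_of_bool; apply/idP/idP; rewrite inE.
Unshelve. all: end_near. Qed.
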